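(* Let $A$ be a $C^*$-algebra, let $p_1$ and $p_2$ be open projections in $A^{**}$, and let $T:X(p_1,p_2)\to X(1,p_2)$ be a local linear transformation. Then $T$ is purely decomposable.
   Context: $A^{**}$ is the enveloping von Neumann algebra (bidual) of $A$; states of $A$ are identified with normal states of $A^{**}$. A projection $p\in A^{**}$ is open if it is the strong limit of an increasing net of positive elements of $A$, and closed if $1-p$ is open. For open projections $p_1,p_2\in A^{**}$, $X(p_1,p_2)=A\cap(p_1A^{**}p_2)$; in particular $X(1,p_2)=A\cap(A^{**}p_2)$. A linear transformation $T:X\to A^{**}p_2$, where $X$ is a subspace of $A^{**}p_2$ (not assumed bounded), is local if for every open projection $q\in A^{**}$ with $q\le p_2$ and every $x\in X$, $xq=0$ implies $(Tx)q=0$. $T$ is purely decomposable if for all pure states $\varphi$ of $A$ and all $x\in X$, $\varphi(x^*x)=0$ implies $\varphi[(Tx)^*(Tx)]=0$. *)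

(* Defs.v *)
From HB Require Import structures.
From mathcomp Require Import all_boot all_order all_algebra.
From mathcomp Require Import complex.
From mathcomp Require Import all_classical all_reals all_analysis.

Set Implicit Arguments.
Unset Strict Implicit.
Unset Printing Implicit Defensive.

Import Order.TTheory GRing.Theory Num.Theory.
Import numFieldNormedType.Exports.

Import ComplexField.Normc.

Local Open Scope classical_set_scope.
Local Open Scope ring_scope.
Local Open Scope complex_scope.

Definition dual_pred (R : realType) (V : normedModType R[i]) :
  {pred V -> R[i]^o} :=
  fun f => `[< linear f /\ continuous f >].

Record dual (R : realType) (V : normedModType R[i]) := MkDual {
  dual_fun :> V -> R[i]^o ;
  dual_funP : dual_fun \in @dual_pred R V }.

Section DualLmodule.
Variables (R : realType) (V : normedModType R[i]).

HB.instance Definition _ := [isSub for @dual_fun R V].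
HB.instance Definition _ := gen_eqMixin (dual V).
HB.instance Definition _ := gen_choiceMixin (dual V).

Lemma dual_linear (f : dual V) : linear f.
Proof. by have /asboolP[] := dual_funP f. Qed.

HB.instance Definition _ (f : dual V) :=
  GRing.isLinear.Build R[i] V R[i]^o *:%R (dual_fun f) (dual_linear f).

Lemma dual_continuous (f : dual V) : continuous f.
Proof. by have /asboolP[] := dual_funP f. Qed.

Lemma dual_pred_submod : submod_closed (@dual_pred R V).
Proof.
split.
  apply/asboolP; split; last exact: cst_continuous.
  by move=> a x y; rewrite scaler0 addr0.
move=> a f g /asboolP[lf cf] /asboolP[lg cg]; apply/asboolP; split.
  move=> k x y.
  have E z : (a *: f + g) z = a *: f z + g z by [].
  rewrite !E lf lg !scalerDr !scalerA [a * k]mulrC -!addrA.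
  by congr (_ + _); rewrite addrCA.
by move=> x; apply: cvgD; [apply: cvgZl_tmp; exact: cf|exact: cg].
Qed.

HB.instance Definition _ := GRing.isSubmodClosed.Build R[i] (V -> R[i]^o)
  (@dual_pred R V) dual_pred_submod.
HB.instance Definition _ :=
  [SubChoice_isSubLmodule of dual V by <:].


Lemma dualDE (f g : dual V) x : (f + g) x = f x + g x.
Proof. by []. Qed.

Lemma dualBE (f g : dual V) x : (f - g) x = f x - g x.
Proof. by []. Qed.

Lemma dualZE a (f : dual V) x : (a *: f) x = a * f x.
Proof. by []. Qed.

Lemma dual_ext (f g : dual V) : f =1 g -> f = g.
Proof. by move=> fg; apply/val_inj/funext. Qed.

Lemma bounded_dual_subproof (f : V -> R[i]) (M : R[i]) :
  linear (f : V -> R[i]^o) -> (forall x, `|f x| <= M * `|x|) ->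
  (f : V -> R[i]^o) \in @dual_pred R V.
Proof.
move=> lf fM; apply/asboolP; split => //.
pose g : {linear V -> R[i]^o} := HB.pack (f : V -> R[i]^o)
  (GRing.isLinear.Build R[i] V R[i]^o *:%R f lf).
apply: (@bounded_linear_continuous _ _ _ g).
apply/bounded_funP => r; exists (`|M| * `|r|) => x xr.
apply: (le_trans (fM x)).
have Mx0 : 0 <= M * `|x| by apply: le_trans (fM x).
rewrite -(ger0_norm Mx0) normrM ler_wpM2l// normr_id.
by rewrite ger0_norm// (le_trans _ xr).
Qed.

Definition mk_dual (f : V -> R[i]) (M : R[i])
    (lf : linear (f : V -> R[i]^o)) (fM : forall x, `|f x| <= M * `|x|) :
  dual V := MkDual (bounded_dual_subproof lf fM).

Definition dual_values (f : dual V) : set R :=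
  [set normc (f x) | x in [set x : V | `|x| <= 1]].

(* Norms take values in R[i], where order is partial: the supremum is taken
   in R and then embedded. *)
Definition dual_norm (f : dual V) : R[i] := (sup (dual_values f))%:C.

Lemma normC_real (z : R[i]) : `|z| = (normc z)%:C.
Proof. by case: z. Qed.

Lemma dual_bounded (f : dual V) :
  exists2 M : R, 0 <= M & forall x, `|f x| <= M%:C * `|x|.
Proof.
have /linear_boundedP[M [Mr /(_ (`|M| + 1))]] :
    bounded_near (f : V -> R[i]^o) (nbhs (0 : V)).
  by apply: continuous_linear_bounded => //; apply: dual_continuous.
have -> : M < `|M| + 1.
  by rewrite (le_lt_trans (real_ler_norm Mr))// ltrDl.
move=> /(_ isT) fM; exists (normc M + 1).
  by rewrite addr_ge0//; case: (M) => a b; exact: sqrtr_ge0.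
by move=> x; have := fM x; rewrite normC_real rmorphD.
Qed.

Lemma dual_values_sup (f : dual V) : has_sup (dual_values f).
Proof.
split; first by exists (normc (f 0)), 0 => //=; rewrite normr0.
have [M M0 fM] := dual_bounded f; exists M => _ [x /= x1 <-].
rewrite -lecR -normC_real (le_trans (fM x))//.
by rewrite -[leRHS]mulr1 ler_wpM2l// lecR.
Qed.

Lemma dual_norm_bound (f : dual V) x : `|f x| <= dual_norm f * `|x|.
Proof.
have [->|x0] := eqVneq x 0; first by rewrite linear0 !normr0 mulr0.
have nx : 0 < `|x| by rewrite normr_gt0.
rewrite -ler_pdivrMr//.
have -> : `|f x| / `|x| = `|f (`|x|^-1 *: x)|.
  by rewrite linearZ/= /GRing.scale/= normrM ger0_norm ?invr_ge0// mulrC.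
rewrite normC_real lecR; apply: sup_upper_bound; first exact: dual_values_sup.
by exists (`|x|^-1 *: x) => //=; rewrite normrZ ger0_norm ?invr_ge0// mulVf// gt_eqF.
Qed.

Lemma dual_norm_le (f : dual V) (M : R) : 0 <= M ->
  (forall x, `|f x| <= M%:C * `|x|) -> dual_norm f <= M%:C.
Proof.
move=> M0 fM; rewrite lecR; apply: ge_sup; first by case: (dual_values_sup f).
move=> _ [x /= x1 <-].
rewrite -lecR -normC_real (le_trans (fM x))//.
by rewrite -[leRHS]mulr1 ler_wpM2l// lecR.
Qed.

Lemma dual_norm_ge0 (f : dual V) : 0 <= dual_norm f.
Proof.
rewrite lecR; apply: (sup_upper_bound (dual_values_sup f)).
by exists 0; rewrite /= ?normr0// linear0 normc0.
Qed.

Lemma dual_ler_normD (f g : dual V) :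
  dual_norm (f + g) <= dual_norm f + dual_norm g.
Proof.
rewrite {2 3}/dual_norm -rmorphD/=; apply: dual_norm_le.
  by rewrite -lecR rmorphD/= addr_ge0//; exact: dual_norm_ge0.
move=> x; rewrite dualDE rmorphD/= mulrDl.
by apply: le_trans (ler_normD _ _) _; rewrite lerD// dual_norm_bound.
Qed.

Lemma dual_normZ_le a (f : dual V) : dual_norm (a *: f) <= `|a| * dual_norm f.
Proof.
rewrite {2}/dual_norm normC_real -rmorphM/=; apply: dual_norm_le.
  by rewrite -lecR rmorphM/= mulr_ge0// ?dual_norm_ge0// -normC_real.
move=> x; rewrite dualZE normrM rmorphM/= -normC_real -mulrA.
by rewrite ler_wpM2l// dual_norm_bound.
Qed.

Lemma dual_normrZ a (f : dual V) : dual_norm (a *: f) = `|a| * dual_norm f.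
Proof.
apply/eqP; rewrite eq_le dual_normZ_le/=.
have [->|a0] := eqVneq a 0; first by rewrite normr0 mul0r dual_norm_ge0.
rewrite -{1}[f](scalerK a0) mulrC -ler_pdivlMr ?normr_gt0// mulrC -normfV.
exact: dual_normZ_le.
Qed.

Lemma dual_norm0_eq0 (f : dual V) : dual_norm f = 0 -> f = 0.
Proof.
move=> f0; apply: dual_ext => x; apply/eqP; rewrite -normr_le0.
by rewrite (le_trans (dual_norm_bound f x))// f0 mul0r.
Qed.

HB.instance Definition _ := Lmodule_isNormed.Build R[i] (dual V)
  dual_ler_normD dual_normrZ dual_norm0_eq0.

Lemma dual_normP (f : dual V) x : `|f x| <= `|f| * `|x|.
Proof. exact: dual_norm_bound. Qed.

End DualLmodule.

Definition bidual (R : realType) (V : normedModType R[i]) := dual (dual V).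

HB.mixin Record isCStarAlgebra (R : realType) A
    & CompleteNormedModule R[i] A := {
  cmul : A -> A -> A ;
  cstar : A -> A ;
  cmulA : forall x y z, cmul x (cmul y z) = cmul (cmul x y) z ;
  cmulDl : forall x y z, cmul (x + y) z = cmul x z + cmul y z ;
  cmulDr : forall x y z, cmul x (y + z) = cmul x y + cmul x z ;
  cmulZl : forall (k : R[i]) x y, cmul (k *: x) y = k *: cmul x y ;
  cmulZr : forall (k : R[i]) x y, cmul x (k *: y) = k *: cmul x y ;
  cstarK : forall x, cstar (cstar x) = x ;
  cstarD : forall x y, cstar (x + y) = cstar x + cstar y ;
  cstarZ : forall (k : R[i]) x, cstar (k *: x) = (k^*)%C *: cstar x ;
  cstarM : forall x y, cstar (cmul x y) = cmul (cstar y) (cstar x) ;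
  cnormM : forall x y, `|cmul x y| <= `|x| * `|y| ;
  cnorm_star : forall x, `|cmul (cstar x) x| = `|x| ^+ 2
}.

(* Not assumed unital. *)
#[short(type="cstarAlgType")]
HB.structure Definition CStarAlgebra (R : realType) :=
  {A of CompleteNormedModule R[i] A & isCStarAlgebra R A}.

Section Arens.
Variables (R : realType) (A : cstarAlgType R).
Implicit Types (a b : A) (f : dual A) (F G : bidual A).

Lemma cnormJ a : `|cstar a| = `|a|.
Proof.
have le b : `|b| <= `|cstar b|.
  have [->|b0] := eqVneq b 0; first by rewrite normr0.
  have nb : 0 < `|b| by rewrite normr_gt0.
  by rewrite -(ler_pM2r nb) -[leLHS]expr2 -cnorm_star; exact: cnormM.
by apply/eqP; rewrite eq_le le andbT -{2}[a]cstarK le.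
Qed.

Lemma dualr_subproof1 f a : linear ((fun b => f (cmul a b)) : A -> R[i]^o).
Proof. by move=> k x y; rewrite cmulDr cmulZr linearP. Qed.

Lemma dualr_subproof2 f a b : `|f (cmul a b)| <= (`|f| * `|a|) * `|b|.
Proof.
apply: (le_trans (dual_normP f _)).
by rewrite -mulrA ler_wpM2l//; exact: cnormM.
Qed.

(* (f . a)(b) = f(ab) *)
Definition dualr f a : dual A :=
  mk_dual (dualr_subproof1 f a) (dualr_subproof2 f a).

Lemma dualr_norm f a : `|dualr f a| <= `|f| * `|a|.
Proof.
have E : `|f| * `|a| = (complex.Re (`|f| * `|a|))%:C.
  by rewrite RRe_real// realM// normr_real.
rewrite E; apply: dual_norm_le.
  by rewrite -lecR -E mulr_ge0.
by move=> b; rewrite -E; exact: dualr_subproof2.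
Qed.

Lemma bidual_act_subproof1 G f :
  linear ((fun a => G (dualr f a)) : A -> R[i]^o).
Proof.
move=> k x y; rewrite -linearP; congr (G _); apply: dual_ext => b /=.
by rewrite cmulDl cmulZl linearP.
Qed.

Lemma bidual_act_subproof2 G f a : `|G (dualr f a)| <= (`|G| * `|f|) * `|a|.
Proof.
apply: (le_trans (dual_normP G _)).
by rewrite -mulrA ler_wpM2l//; exact: dualr_norm.
Qed.

(* (G . f)(a) = G(f . a) *)
Definition bidual_act G f : dual A :=
  mk_dual (bidual_act_subproof1 G f) (bidual_act_subproof2 G f).

Lemma bidual_act_norm G f : `|bidual_act G f| <= `|G| * `|f|.
Proof.
have E : `|G| * `|f| = (complex.Re (`|G| * `|f|))%:C.
  by rewrite RRe_real// realM// normr_real.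
rewrite E; apply: dual_norm_le.
  by rewrite -lecR -E mulr_ge0.
by move=> b; rewrite -E; exact: bidual_act_subproof2.
Qed.

Lemma bmul_subproof1 F G :
  linear ((fun f => F (bidual_act G f)) : dual A -> R[i]^o).
Proof.
move=> k x y; rewrite -linearP; congr (F _); apply: dual_ext => a /=.
rewrite -[RHS]/(k * G (dualr x a) + G (dualr y a)).
rewrite -[k * _ + _]/(k *: (G (dualr x a) : R[i]^o) + G (dualr y a)) -linearP.
by congr (G _); apply: dual_ext.
Qed.

Lemma bmul_subproof2 F G f :
  `|F (bidual_act G f)| <= (`|F| * `|G|) * `|f|.
Proof.
apply: (le_trans (dual_normP F _)).
by rewrite -mulrA ler_wpM2l//; exact: bidual_act_norm.
Qed.

(* First Arens product, (FG)(f) = F(G . f). C*-algebras being Arens regular,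
   it is the unique separately weak*-continuous extension of the product of A,
   and with it the bidual is the enveloping von Neumann algebra of A. *)
Definition bmul F G : bidual A :=
  mk_dual (bmul_subproof1 F G) (bmul_subproof2 F G).

Lemma dual_star_subproof1 f :
  linear ((fun a => (f (cstar a))^*%C) : A -> R[i]^o).
Proof.
move=> k x y; rewrite cstarD cstarZ linearP rmorphD /=.
by rewrite /GRing.scale/= rmorphM/= conjcK.
Qed.

Lemma dual_star_subproof2 f a : `|(f (cstar a))^*%C| <= `|f| * `|a|.
Proof. by rewrite normcJ -(cnormJ a); exact: dual_normP. Qed.

Definition dual_star f : dual A :=
  mk_dual (dual_star_subproof1 f) (dual_star_subproof2 f).

Lemma dual_star_norm f : `|dual_star f| <= `|f|.
Proof. by apply: dual_norm_le => [|a]; [rewrite -lecR dual_norm_ge0|exact: dual_star_subproof2]. Qed.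

Lemma bstar_subproof1 F :
  linear ((fun f => (F (dual_star f))^*%C) : dual A -> R[i]^o).
Proof.
move=> k x y.
have -> : dual_star (k *: x + y) = (k^*)%C *: dual_star x + dual_star y.
  by apply: dual_ext => a /=; rewrite rmorphD rmorphM.
rewrite linearP rmorphD /= /GRing.scale/= rmorphM/=.
by rewrite conjcK.
Qed.

Lemma bstar_subproof2 F f : `|(F (dual_star f))^*%C| <= `|F| * `|f|.
Proof.
by rewrite normcJ (le_trans (dual_normP F _))// ler_wpM2l// dual_star_norm.
Qed.

Definition bstar F : bidual A :=
  mk_dual (bstar_subproof1 F) (bstar_subproof2 F).

Lemma embed_subproof1 a : linear ((fun f => f a) : dual A -> R[i]^o).
Proof. by []. Qed.

Lemma embed_subproof2 a f : `|f a| <= `|a| * `|f|.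
Proof. by rewrite mulrC; exact: dual_normP. Qed.

Definition embed a : bidual A :=
  mk_dual (embed_subproof1 a) (embed_subproof2 a).

Lemma embedM a b : embed (cmul a b) = bmul (embed a) (embed b).
Proof. exact: dual_ext. Qed.

Lemma embed_star a : embed (cstar a) = bstar (embed a).
Proof. by apply: dual_ext => f /=; rewrite conjcK. Qed.

End Arens.

Section OpenProjections.
Variables (R : realType) (A : cstarAlgType R).
Implicit Types (a : A) (f phi : dual A) (F G p q : bidual A).

Definition cpositive a := exists b : A, a = cmul (cstar b) b.

Definition positive_functional f := forall a, 0 <= f (cmul (cstar a) a).

Definition state phi := positive_functional phi /\ `|phi| = 1.

Definition pure_state phi := state phi /\
  forall f, positive_functional f -> positive_functional (phi - f) ->
  exists t : R[i], f = t *: phi.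

Definition projection p := bmul p p = p /\ bstar p = p.

Definition increasing_net (I : Type) (le : I -> I -> Prop) (u : I -> A) :=
  [/\ inhabited I, (forall i, le i i),
      (forall i j k, le i j -> le j k -> le i k),
      (forall i j, exists k, le i k /\ le j k) &
      (forall i j, le i j -> cpositive (u j - u i))].

(* The vector states of the universal representation are the states of A,
   evaluated on the bidual by F |-> F phi; so ||F xi||^2 = (F^*F) phi. *)
Definition strong_limit (I : Type) (le : I -> I -> Prop) (u : I -> A) F :=
  forall phi, state phi -> forall e : R[i], 0 < e ->
  exists i, forall j, le i j ->
    `|bmul (bstar (F - embed (u j))) (F - embed (u j)) phi| < e.

Definition open_projection p := projection p /\
  exists (I : Type) (le : I -> I -> Prop) (u : I -> A),
    [/\ increasing_net le u, (forall i, cpositive (u i)) & strong_limit le u p].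

Definition proj_le p q := bmul p q = p.

Definition Xspace p1 p2 : set (bidual A) :=
  range (@embed R A) `&` [set bmul (bmul p1 F) p2 | F in [set: bidual A]].

(* X(1, p2), written without the unit of the bidual. *)
Definition Xspace1 p2 : set (bidual A) :=
  range (@embed R A) `&` [set bmul F p2 | F in [set: bidual A]].

(* A linear map between subspaces is represented by a total function, whose
   values outside D are irrelevant. *)
Definition linear_map (D E : set (bidual A)) (T : bidual A -> bidual A) :=
  (forall F, D F -> E (T F)) /\
  (forall (k : R[i]) F G, D F -> D G -> T (k *: F + G) = k *: T F + T G).

Definition local_map (D : set (bidual A)) p2 (T : bidual A -> bidual A) :=
  forall q, open_projection q -> proj_le q p2 ->
  forall F, D F -> bmul F q = 0 -> bmul (T F) q = 0.

Definition purely_decomposable (D : set (bidual A))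
    (T : bidual A -> bidual A) :=
  forall phi, pure_state phi -> forall F, D F ->
  bmul (bstar F) F phi = 0 -> bmul (bstar (T F)) (T F) phi = 0.

End OpenProjections.

(* Main.v *)
(* Let x be in X(p1,p2) and w = T x, seen as elements of A. Functional calculus
   in k = x^*x gives cutoffs r_j (equal to 0 near 0 and to 1 away from 0) with
   r_j r_(j+1) = r_j and x r_j -> x. Locality, applied to the range projection
   of g, says that y g = 0 implies (T y) g = 0, for g self-adjoint in A with
   g p2 = g. A gliding hump along the shells r_j - r_i shows that w r_j
   converges: else some y would coincide with 2^n x on the n-th shell, hence T y
   with 2^n w, although w is not small there. If v = w - lim w r_j, then
   v x^* = 0, so locality with g = v^*v gives w v^*v = 0, whence v = 0. Thus w is
   a limit of left multiples of x, and any positive functional vanishing at x^*x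
   vanishes at w^*w. *)
Require Import Defs.
From HB Require Import structures.
From mathcomp Require Import all_boot all_order all_algebra.
From mathcomp Require Import complex.
From mathcomp Require Import all_classical all_reals all_analysis.
From mathcomp Require Import ring lra.

Set Implicit Arguments.
Unset Strict Implicit.
Unset Printing Implicit Defensive.

Import Order.TTheory GRing.Theory Num.Theory.
Import numFieldNormedType.Exports.

Local Open Scope classical_set_scope.
Local Open Scope ring_scope.
Local Open Scope complex_scope.

(** * Real-valued norms *)

(** The functional calculus is built without spectra, for two reasons: A may lack a unit, and
    positivity of x^*x is itself a theorem. It takes place in a commutative real ring of
    self-adjoint operators on A, where identities are settled by [ring], positive means being a
    square, and norm bounds come from sums of two squares. T carries no bound, so no limit can be
    taken under T; every limit statement about w has to be extracted from annihilation relations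
    alone. The cutoffs are functions of x^*x because they must act on the right of x and lie in the
    left ideal generated by x: this places them in the ideal cut out by p2, where locality can be
    tested. Locality is a statement about the bidual while the argument runs in A. The way up is the
    range projection of g, a weak limit of squares of cutoffs of g; the way back is injectivity of
    the embedding, which rests on a Hahn-Banach theorem. *)

Section RealNorm.
Variables (R : realType) (V : normedModType R[i]).
Implicit Types (u v : V) (t : R).

(* Norms of complex normed modules take values in R[i]; [nr] is the same norm
   with values in R. *)
Definition nr v : R := complex.Re `|v|.

Lemma nrE v : `|v| = (nr v)%:C.
Proof. by rewrite /nr RRe_real// normr_real. Qed.

Lemma nr_ge0 v : 0 <= nr v.
Proof. by rewrite -lecR -nrE normr_ge0. Qed.

Lemma nr0 : nr (0 : V) = 0.
Proof. by rewrite /nr normr0. Qed.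

Lemma nr0_eq0 v : nr v = 0 -> v = 0.
Proof. by move=> v0; apply/eqP; rewrite -normr_eq0 nrE v0. Qed.

Lemma nrD u v : nr (u + v) <= nr u + nr v.
Proof. by rewrite -lecR rmorphD/= -!nrE ler_normD. Qed.

Lemma nrN v : nr (- v) = nr v.
Proof. by rewrite /nr normrN. Qed.

Lemma nrB u v : nr (u - v) <= nr u + nr v.
Proof. by rewrite -(nrN v) nrD. Qed.

Lemma nr_distC u v : nr (u - v) = nr (v - u).
Proof. by rewrite /nr distrC. Qed.

Lemma nr_triangle w u v : nr (u - v) <= nr (u - w) + nr (w - v).
Proof. by rewrite (le_trans _ (nrD _ _))// addrA subrK. Qed.

Lemma nrZ t v : nr (t%:C *: v) = `|t| * nr v.
Proof.
by apply: complexI; rewrite -nrE normrZ rmorphM/= -nrE normC_real /= expr0n addr0 sqrtr_sqr.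
Qed.

End RealNorm.
Lemma nr_complex_le (R : realType) (z : R[i]^o) :
  nr z <= `|complex.Re z| + `|complex.Im z|.
Proof.
case: z => a b; rewrite -lecR -nrE normC_real lecR/=.
rewrite -[leRHS]ger0_norm ?addr_ge0// -sqrtr_sqr ler_wsqrtr//.
rewrite sqrrD !real_normK ?num_real//.
by rewrite lerD2r lerDl mulrn_wge0 ?mulr_ge0.
Qed.

(** * Functionals separate points *)

Section HahnBanach.
Variables (R : realType) (V : normedModType R[i]).
Implicit Types (u v w : V) (p : V -> R).

(** Only real scalars are involved. An inequality is enough in the scaling law: applying it to the
    inverse scalar gives equality. *)
Definition sublinear p := [/\ forall u v, p (u + v) <= p u + p v,
  forall (t : R) u, 0 < t -> p (t%:C *: u) <= t * p u & forall u, p u <= nr u].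

Lemma sublinear_nr : sublinear (@nr R V).
Proof. by split=> [u v|t u t0|//]; [exact: nrD|rewrite nrZ gtr0_norm]. Qed.

Lemma scalerKC (t : R) u : t != 0 -> t^-1%:C *: (t%:C *: u) = u.
Proof. by move=> t0; rewrite scalerA -rmorphM/= mulVf// scale1r. Qed.

Lemma sublinearZ p t u : sublinear p -> 0 < t -> p (t%:C *: u) = t * p u.
Proof.
move=> [_ pZ _] t0; apply/eqP; rewrite eq_le pZ//=.
have tV : 0 < t^-1 by rewrite invr_gt0.
by rewrite -ler_pdivlMl// -{1}(scalerKC u (lt0r_neq0 t0)) pZ.
Qed.

Lemma sublinear0 p : sublinear p -> p 0 = 0.
Proof.
move=> ps; have := sublinearZ 0 ps (ltr0n R 2); rewrite scaler0.
lra.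
Qed.

Lemma sublinear_geN p u v : sublinear p -> p v - p (- u) <= p (u + v).
Proof.
move=> [pD _ _]; rewrite lerBlDr -{1}(addKr u v) addrC [p _ + p _]addrC.
by rewrite (le_trans (pD _ _))// addrC.
Qed.

Lemma sublinear_ge p u : sublinear p -> - nr u <= p u.
Proof.
move=> ps; have := sublinear_geN u 0 ps; rewrite addr0 sublinear0// sub0r.
by apply: le_trans; rewrite lerN2 -(nrN u); have [_ _ ->] := ps.
Qed.

Section Improve.
Variables (p : V -> R) (v : V).
Hypothesis ps : sublinear p.

Definition improve_values u : set R :=
  [set p (u + t%:C *: v) - t * p v | t in [set t | 0 <= t]].

(* The largest sublinear functional below p taking the value -p(v) at -v *)
Definition improve u := inf (improve_values u).

Lemma sublinearZ_ge0 t u : 0 <= t -> p (t%:C *: u) = t * p u.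
Proof.
rewrite le_eqVlt => /predU1P[<-|]; last exact: sublinearZ.
by rewrite scale0r mul0r sublinear0.
Qed.

Lemma improve_le u t : 0 <= t -> improve u <= p (u + t%:C *: v) - t * p v.
Proof.
move=> t0; apply: ge_inf; last by exists t.
exists (- p (- u)) => _ [s /= s0 <-].
by have := sublinear_geN u (s%:C *: v) ps; rewrite sublinearZ_ge0//; lra.
Qed.

Lemma improve_ge u c :
  (forall t, 0 <= t -> c <= p (u + t%:C *: v) - t * p v) -> c <= improve u.
Proof.
move=> cp; apply: lb_le_inf; last by move=> _ [t /= t0 <-]; exact: cp.
by exists (p (u + 0%:C *: v) - 0 * p v), 0 => /=.
Qed.

Lemma sublinear_improve : sublinear improve.
Proof.
have [pD pZ pn] := ps; split=> [u w|t u t0|u].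
- rewrite -lerBlDr; apply: improve_ge => t t0.
  rewrite lerBlDr [leRHS]addrC -lerBlDr; apply: improve_ge => s s0.
  rewrite lerBlDr.
  apply: le_trans (improve_le (u + w) (addr_ge0 t0 s0)) _.
  rewrite rmorphD/= scalerDl addrACA.
  by have := pD (u + t%:C *: v) (w + s%:C *: v); lra.
- rewrite -ler_pdivrMl//; apply: improve_ge => s s0; rewrite ler_pdivrMl//.
  apply: le_trans (improve_le (t%:C *: u) (mulr_ge0 (ltW t0) s0)) _.
  rewrite rmorphM/= -scalerA -scalerDr (sublinearZ _ ps t0).
  lra.
- apply: le_trans (improve_le u (lexx 0)) _.
  by rewrite scale0r addr0 mul0r subr0.
Qed.

Lemma improve_le_self u : improve u <= p u.
Proof.
by have := improve_le u (lexx 0); rewrite scale0r addr0 mul0r subr0.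
Qed.

End Improve.

Lemma improveN p v : sublinear p -> improve p v (- v) <= - p v.
Proof.
move=> ps; have := improve_le v ps (- v) ler01.
by rewrite scale1r addNr sublinear0// mul1r sub0r.
Qed.

(** Minimal sublinear functionals will turn out to be additive. Zorn's lemma applies downwards: the
    pointwise infimum of a chain is finite because each member is at least [- nr u], and subadditive
    because two members of a chain are comparable. *)
Lemma exists_minimal_sublinear p0 : sublinear p0 -> exists p,
  [/\ sublinear p, forall u, p u <= p0 u &
    forall p', sublinear p' -> (forall u, p' u <= p u) -> forall u, p u <= p' u].
Proof.
move=> p0s; pose T := {p | sublinear p /\ forall u, p u <= p0 u}.
pose r : rel T := fun a b => `[< forall u, sval b u <= sval a u >].
have t0 : T by exists p0.
have [||C Ctot|[p [ps pp0]] pmin] := @ZL_preorder T t0 r.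
- by move=> p; apply/asboolP.
- move=> p p' p'' /asboolP pp /asboolP pp'; apply/asboolP => u.
  exact: le_trans (pp' u) (pp u).
- have [[c0 Cc0]|C0] := pselect (exists c, C c); last first.
    by exists t0 => s Cs; case: C0; exists s.
  pose q u := inf [set sval c u | c in C].
  have qle u c : C c -> q u <= sval c u.
    move=> Cc; apply: ge_inf; last by exists c.
    by exists (- nr u) => _ [d _ <-]; apply: sublinear_ge; have [] := svalP d.
  have qge u (x : R) : (forall c, C c -> x <= sval c u) -> x <= q u.
    by move=> xc; apply: lb_le_inf => [|_ [c Cc <-]]; [exists (sval c0 u), c0|exact: xc].
  have qs : sublinear q.
    split=> [u v|t u t1|u].
    + rewrite -lerBlDr; apply: (qge u) => c Cc.
      rewrite lerBlDr [leRHS]addrC -lerBlDr; apply: (qge v) => d Cd; rewrite lerBlDr.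
      have [[cD _ _] _] := svalP c; have [[dD _ _] _] := svalP d.
      have [/asboolP cd|/asboolP dc] := Ctot _ _ Cc Cd.
        apply: le_trans (qle _ _ Cd) _; apply: le_trans (dD _ _) _.
        by rewrite addrC lerD2l.
      apply: le_trans (qle _ _ Cc) _; apply: le_trans (cD _ _) _.
      by rewrite addrC lerD2r.
    + rewrite -ler_pdivrMl//; apply: qge => c Cc; rewrite ler_pdivrMl//.
      apply: le_trans (qle _ _ Cc) _.
      by have [[_ cZ _] _] := svalP c; exact: cZ.
    + apply: le_trans (qle _ _ Cc0) _.
      by have [[_ _ ->] _] := svalP c0.
  have qp0 u : q u <= p0 u.
    by apply: le_trans (qle _ _ Cc0) _; have [_] := svalP c0.
  by exists (exist _ q (conj qs qp0)) => s Cs; apply/asboolP => u; exact: qle.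
exists p; split=> // p' p's p'p.
have p'p0 u : p' u <= p0 u by rewrite (le_trans (p'p u)).
have := pmin (exist _ p' (conj p's p'p0)).
by rewrite /r /= => H; apply/asboolP/H/asboolP.
Qed.

(** Improving the norm in the direction v forces the value at v. For p minimal below it, comparison
    with [improve p w] gives p u <= p (u + w) - p w, the missing half of additivity. *)
Lemma exists_real_functional v : exists p : V -> R,
  [/\ {morph p : u w / u + w}, forall t u, p (t%:C *: u) = t * p u,
      forall u, `|p u| <= nr u & nr v <= p v].
Proof.
have [p [ps pv pmin]] := exists_minimal_sublinear (sublinear_improve v sublinear_nr).
have pD : {morph p : u w / u + w}.
  move=> u w; apply/eqP; rewrite eq_le; have [-> _ _]/= := ps.
  have := pmin _ (sublinear_improve w ps) (improve_le_self w ps) u.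
  have := improve_le w ps u ler01; rewrite scale1r mul1r; lra.
have pN u : p (- u) = - p u.
  by apply/eqP; rewrite -addr_eq0 -pD addNr sublinear0.
have pZ t u : p (t%:C *: u) = t * p u.
  have [t0|t0|->] := ltgtP t 0; last by rewrite scale0r mul0r sublinear0.
    rewrite -(opprK t) rmorphN scaleNr pN (sublinearZ _ ps) ?oppr_gt0//.
    by rewrite !mulNr.
  exact: sublinearZ.
exists p; split=> //.
  move=> u; rewrite ler_norml sublinear_ge//=.
  by have [_ _ ->] := ps.
have := le_trans (pv (- v)) (improveN v sublinear_nr).
by rewrite pN lerN2.
Qed.

Lemma dual_separates v : (forall f : dual V, f v = 0) -> v = 0.
Proof.
move=> fv0; have [p [pD pZ pn pv]] := exists_real_functional v.
(* The complex-linear functional with real part p. The constant 2 in its bound adds the bounds of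
   the real and imaginary parts. *)
pose f u := (p u)%:C - 'i%C * (p ('i%C *: u))%:C.
have pi u : p ('i%C *: ('i%C *: u)) = - p u.
  by rewrite scalerA -expr2 sqr_i -(rmorph1 (real_complex R)) -rmorphN/= pZ mulN1r.
have flin : linear (f : V -> R[i]^o).
  move=> k u w; rewrite -[k *: (f u : R[i]^o)]/(k * f u) /f.
  case: k => a b.
  have kE u' : (a +i* b) *: u' = a%:C *: u' + b%:C *: ('i%C *: u').
    rewrite scalerA -scalerDl; congr (_ *: _); apply/eqP.
    by rewrite eq_complex/=; apply/andP; split; apply/eqP; ring.
  have swap (t : R) u' : 'i%C *: (t%:C *: u') = t%:C *: ('i%C *: u').
    by rewrite !scalerA mulrC.
  rewrite scalerDr !kE !scalerDr !pD !swap !pZ pi.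
  by apply/eqP; rewrite eq_complex/=; apply/andP; split; apply/eqP; ring.
have fbd u : `|f u| <= 2%:C * `|u|.
  have ni : nr ('i%C *: u) = nr u.
    apply: complexI; rewrite -!nrE normrZ normC_real /= expr0n add0r expr1n sqrtr1.
    by rewrite mul1r.
  rewrite (nrE (f u : R[i]^o)) nrE -rmorphM lecR.
  apply: le_trans (nr_complex_le _) _.
  rewrite mulr_natl mulr2n lerD//.
    by rewrite /f /= !mul0r !mulr0 subr0 oppr0 addr0 pn.
  by have := pn ('i%C *: u); rewrite ni /f /= !mul0r !mul1r sub0r add0r normrN.
have := fv0 (mk_dual flin fbd).
move=> /(congr1 (@complex.Re R)) /=.
rewrite mul0r mulr0 subr0 oppr0 addr0 => E; apply: nr0_eq0; apply/eqP.
by rewrite eq_le nr_ge0 andbT -E.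
Qed.

End HahnBanach.

(** * Convergence in C*-algebras *)

Section Convergence.
Variables (R : realType).

Lemma cvg_nrP (V : normedModType R[i]) (u : nat -> V) (l : V) :
  u @ \oo --> l <->
  forall e : R, 0 < e -> exists N, forall n, (N <= n)%N -> nr (l - u n) <= e.
Proof.
split=> [/cvgrPdist_le ul e e0|ul].
  have [|N _ uN] := ul e%:C; first by rewrite ltcR.
  by exists N => n /uN /=; rewrite nrE lecR.
apply/cvgrPdist_le => e e0.
have er : (complex.Re e)%:C = e by rewrite RRe_real// gtr0_real.
have [|N uN] := ul (complex.Re e); first by rewrite -ltcR er.
by exists N => // n /uN /=; rewrite nrE -er lecR.
Qed.

Lemma nr_cauchy_cvg (V : completeNormedModType R[i]) (u : nat -> V) :
  (forall e : R, 0 < e -> exists N, forall m n, (N <= m <= n)%N ->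
    nr (u n - u m) <= e) -> cvgn u.
Proof.
move=> uc; apply/cauchy_cvgP/cauchyP => e e0.
have er : (complex.Re e)%:C = e by rewrite RRe_real// gtr0_real.
have [|N uN] := uc (complex.Re e / 2).
  by rewrite divr_gt0// -ltcR er.
exists (u N); exists N => // n /= Nn.
rewrite -ball_normE /= distrC nrE -er ltcR.
rewrite (le_lt_trans (uN _ _ _)) ?leqnn//.
by rewrite ltr_pdivrMr// ltr_pMr ?ltr1n// -ltcR er.
Qed.

Lemma nondecreasing_bounded_cauchy (s : nat -> R) (c : R) :
  (forall n, s n <= s n.+1) -> (forall n, s n <= c) ->
  forall e : R, 0 < e -> exists N, forall m n, (N <= m <= n)%N -> s n - s m <= e.
Proof.
move=> s_incr s_le e e0; pose l := sup (range s).
have ls : has_sup (range s) by split; [exists (s 0%N), 0%N|exists c => _ [n _ <-]].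
have [_ [N _ <-] lN] := sup_adherent e0 ls.
have /nondecreasing_seqP s_mono := s_incr.
exists N => m n /andP[Nm mn]; rewrite -/l in lN.
have : s n <= l by apply: sup_upper_bound => //; exists n.
have : s N <= s m by exact: s_mono.
lra.
Qed.

Lemma dominated_cvg (V : completeNormedModType R[i])
    (u : nat -> V) (s : nat -> R) (c : R) :
  (forall n, nr (u n.+1 - u n) <= s n.+1 - s n) ->
  (forall n, s n <= s n.+1) -> (forall n, s n <= c) -> cvgn u.
Proof.
move=> us s_incr s_le; apply: nr_cauchy_cvg => e e0.
have [N sN] := nondecreasing_bounded_cauchy s_incr s_le e0.
exists N => m n Nmn; apply: le_trans (sN _ _ Nmn).
case/andP: Nmn => _ mn; rewrite -(subnK mn).
elim: (n - m)%N => [|i IH]; first by rewrite add0n !subrr nr0.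
rewrite addSn; apply: le_trans (nr_triangle (u (i + m)%N) _ _) _.
by have := us (i + m)%N; move: IH; lra.
Qed.

Lemma nr_cvg_le (V : normedModType R[i]) (u : nat -> V) (l v : V) (c : R) N :
  u @ \oo --> l -> (forall n, (N <= n)%N -> nr (u n - v) <= c) ->
  nr (l - v) <= c.
Proof.
move=> /cvg_nrP ul uc; apply/ler_addgt0Pr => e e0.
have [M uM] := ul e e0.
rewrite (le_trans (nr_triangle (u (maxn N M)) _ _))// addrC lerD//.
  by rewrite uc// leq_maxl.
by rewrite uM// leq_maxr.
Qed.

Lemma nr_le_eq0 (V : normedModType R[i]) (v : V) :
  (forall e : R, 0 < e -> nr v <= e) -> v = 0.
Proof.
move=> ve; apply: nr0_eq0; apply/eqP; rewrite eq_le nr_ge0 andbT.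
by apply/ler_addgt0Pr => e /ve; rewrite add0r.
Qed.

Lemma cvg_bounded_additive (V W : normedModType R[i]) (f : V -> W) (c : R) u l :
  {morph f : x y / x - y} -> (forall v, nr (f v) <= c * nr v) ->
  u @ \oo --> l -> f (u n) @[n --> \oo] --> f l.
Proof.
move=> fB fc /cvg_nrP ul; apply/cvg_nrP => e e0.
have c1 : 0 < `|c| + 1 by rewrite ltr_wpDl.
have [|N uN] := ul (e / (`|c| + 1)); first by rewrite divr_gt0.
exists N => n /uN un; rewrite -fB (le_trans (fc _))//.
rewrite (@le_trans _ _ ((`|c| + 1) * nr (l - u n)))//.
  by rewrite ler_wpM2r ?nr_ge0// (le_trans (ler_norm c))// lerDl.
by rewrite -ler_pdivlMl// mulrC.
Qed.

End Convergence.

(** * Product and involution without a unit *)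

Section CStarBasics.
Variables (R : realType) (A : cstarAlgType R).
Implicit Types (a b c x y : A).

Lemma cmulNl a b : cmul (- a) b = - cmul a b.
Proof. by rewrite -scaleN1r cmulZl scaleN1r. Qed.

Lemma cmulNr a b : cmul a (- b) = - cmul a b.
Proof. by rewrite -scaleN1r cmulZr scaleN1r. Qed.

Lemma cmulBl a b c : cmul (a - b) c = cmul a c - cmul b c.
Proof. by rewrite cmulDl cmulNl. Qed.

Lemma cmulBr a b c : cmul a (b - c) = cmul a b - cmul a c.
Proof. by rewrite cmulDr cmulNr. Qed.

Lemma cmul0l a : cmul 0 a = 0.
Proof. by rewrite -(subrr a) cmulBl !subrr. Qed.

Lemma cmul0r a : cmul a 0 = 0.
Proof. by rewrite -(subrr a) cmulBr !subrr. Qed.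

Lemma cstar0 : cstar 0 = 0 :> A.
Proof. by apply: (addrI (cstar 0)); rewrite -cstarD !addr0. Qed.

Lemma cstarN a : cstar (- a) = - cstar a.
Proof. by rewrite -scaleN1r cstarZ rmorphN1 scaleN1r. Qed.

Lemma cstarB a b : cstar (a - b) = cstar a - cstar b.
Proof. by rewrite cstarD cstarN. Qed.

Lemma cstarZr (t : R) a : cstar (t%:C *: a) = t%:C *: cstar a.
Proof. by rewrite cstarZ; congr (_ *: _); apply/eqP; rewrite eq_complex/= oppr0 !eqxx. Qed.

Lemma nr_cmul a b : nr (cmul a b) <= nr a * nr b.
Proof. by rewrite -lecR rmorphM/= -!nrE cnormM. Qed.

Lemma nr_cstar a : nr (cstar a) = nr a.
Proof. by rewrite /nr cnormJ. Qed.

Lemma nr_cstar_cmul a : nr (cmul (cstar a) a) = nr a ^+ 2.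
Proof. by apply: complexI; rewrite -nrE cnorm_star nrE rmorphXn. Qed.

Lemma cstar_cmul_eq0 a : cmul (cstar a) a = 0 -> a = 0.
Proof.
move=> a0; apply: nr0_eq0; apply/eqP.
by rewrite -sqrf_eq0 -nr_cstar_cmul a0 nr0.
Qed.

(** Taking c = a - b, the C*-identity makes testing against left factors faithful; this stands in
    for multiplying by a unit. *)
Lemma cmul_nondeg a b : (forall c, cmul (cstar c) a = cmul (cstar c) b) -> a = b.
Proof.
move=> ab; apply/eqP; rewrite -subr_eq0; apply/eqP/cstar_cmul_eq0.
by rewrite cmulBr ab subrr.
Qed.

Lemma cmul_nondegr a b : (forall c, cmul a c = cmul b c) -> a = b.
Proof.
move=> ab; rewrite -(cstarK a) -(cstarK b); congr (cstar _).
by apply: cmul_nondeg => c; rewrite -!cstarM ab.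
Qed.

Lemma cvg_cmull c (u : nat -> A) l :
  u @ \oo --> l -> cmul c (u n) @[n --> \oo] --> cmul c l.
Proof.
by apply: cvg_bounded_additive => [x y|x]; [exact: cmulBr|exact: nr_cmul].
Qed.

Lemma cvg_cmulr c (u : nat -> A) l :
  u @ \oo --> l -> cmul (u n) c @[n --> \oo] --> cmul l c.
Proof.
apply: (cvg_bounded_additive (f := fun a => cmul a c) (c := nr c)) => [x y|x].
  exact: cmulBl.
by rewrite mulrC; exact: nr_cmul.
Qed.

Lemma cvg_cstar (u : nat -> A) l :
  u @ \oo --> l -> cstar (u n) @[n --> \oo] --> cstar l.
Proof.
by apply: (cvg_bounded_additive (c := 1)) => [x y|x];
  rewrite ?mul1r ?nr_cstar//; exact: cstarB.
Qed.

End CStarBasics.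

(** * Commutative operator algebras *)

Section BoundedOperators.
Variables (R : realType) (A : cstarAlgType R).
Implicit Types (f g : A -> A) (a b : A) (c d : R).

(** Self-adjointness for the A-valued inner product of A as a right Hilbert module over itself. By
    nondegeneracy it entails linearity and commutation with right multiplications. *)
Definition selfadj f := forall a b, cmul (cstar (f a)) b = cmul (cstar a) (f b).

(** An operator norm bound, kept as a relation so that no supremum has to be formed. *)
Definition bd f c := forall a, nr (f a) <= c * nr a.

Lemma selfadj_linear f : selfadj f -> linear f.
Proof.
move=> fs t a b; apply: cmul_nondeg => c.
by rewrite -fs cmulDr cmulZr !fs cmulDr cmulZr.
Qed.

Lemma selfadjB f : selfadj f -> {morph f : a b / a - b}.
Proof.
by move=> /selfadj_linear fl a b; rewrite addrC -scaleN1r fl scaleN1r addrC.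
Qed.

Lemma selfadj0 f : selfadj f -> f 0 = 0.
Proof. by move=> /selfadjB fB; rewrite -[X in f X](subrr 0) fB subrr. Qed.

Lemma selfadjM f a b : selfadj f -> f (cmul a b) = cmul (f a) b.
Proof. by move=> fs; apply: cmul_nondeg => c; rewrite -fs !cmulA fs. Qed.

Lemma cvg_selfadj f c u l : selfadj f -> bd f c ->
  u @ \oo --> l -> f (u n) @[n --> \oo] --> f l.
Proof. by move=> /selfadjB fB fc; exact: cvg_bounded_additive. Qed.

Lemma bd_le f c d : bd f c -> c <= d -> bd f d.
Proof. by move=> fc cd a; rewrite (le_trans (fc a))// ler_wpM2r// nr_ge0. Qed.

Lemma bd_gt0 f c : bd f c -> exists2 d, 0 < d & bd f d.
Proof.
move=> fc; exists (`|c| + 1); first by rewrite ltr_wpDl.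
by apply: bd_le fc _; rewrite (le_trans (ler_norm c))// lerDl.
Qed.

Lemma selfadj_cmul a : cstar a = a -> selfadj (cmul a).
Proof. by move=> aa b c; rewrite cstarM aa cmulA. Qed.

Lemma bd_cmul a : bd (cmul a) (nr a).
Proof. exact: nr_cmul. Qed.

End BoundedOperators.

(* The bicommutant of left multiplication by x^*x in the bounded adjointable
   operators on A; its self-adjoint part is a commutative real algebra which
   has a unit even when A has none. *)
Definition op_pred (R : realType) (A : cstarAlgType R) (x : A) :
    {pred A -> A} :=
  fun f => `[< [/\ selfadj f, exists c, bd f c &
    forall g, selfadj g -> (exists c, bd g c) ->
      (forall a, g (cmul (cmul (cstar x) x) a) = cmul (cmul (cstar x) x) (g a)) ->
      forall a, f (g a) = g (f a)] >].

Record op (R : realType) (A : cstarAlgType R) (x : A) := MkOp {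
  op_fun :> A -> A ;
  op_funP : op_fun \in op_pred x }.

Section OpRing.
Variables (R : realType) (A : cstarAlgType R) (x : A).
Implicit Types (f g : op x) (a b : A) (c d t : R).

Let k := cmul (cstar x) x.

HB.instance Definition _ := [isSub for @op_fun R A x].
HB.instance Definition _ := gen_eqMixin (op x).
HB.instance Definition _ := gen_choiceMixin (op x).

Lemma op_selfadj f : selfadj f.
Proof. by have /asboolP[] := op_funP f. Qed.

Lemma op_bd f : exists c, bd f c.
Proof. by have /asboolP[] := op_funP f. Qed.

Lemma op_comm f (g : A -> A) : selfadj g -> (exists c, bd g c) ->
  (forall a, g (cmul k a) = cmul k (g a)) -> forall a, f (g a) = g (f a).
Proof. by have /asboolP[_ _] := op_funP f; exact. Qed.

Lemma op_zmod_closed : zmod_closed (op_pred x).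
Proof.
split=> [|f g /asboolP[fs [c fc] fC] /asboolP[gs [d gd] gC]]; apply/asboolP.
  split.
  - by move=> a b; rewrite /= cmul0r cstar0 cmul0l.
  - by exists 0 => a; rewrite /= nr0 mul0r.
  - move=> g gs _ _ a /=; rewrite -[RHS]/(g 0) selfadj0//.
have E a : (f - g) a = f a - g a by [].
split.
- by move=> a b; rewrite !E cstarB cmulBl cmulBr fs gs.
- by exists (c + d) => a; rewrite E mulrDl (le_trans (nrB _ _))// lerD.
- by move=> h hs hc hk a; rewrite !E (selfadjB hs) fC// gC.
Qed.

HB.instance Definition _ := GRing.isZmodClosed.Build (A -> A) (op_pred x)
  op_zmod_closed.
HB.instance Definition _ := [SubChoice_isSubZmodule of op x by <:].

Lemma op_ext f g : f =1 g -> f = g.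
Proof. by move=> fg; apply/val_inj/funext. Qed.

Lemma op_addE f g a : (f + g) a = f a + g a.
Proof. by []. Qed.

Lemma op_subE f g a : (f - g) a = f a - g a.
Proof. by []. Qed.

Lemma cstar_sq : cstar k = k.
Proof. by rewrite cstarM cstarK. Qed.

Lemma op_comm_sq f a : f (cmul k a) = cmul k (f a).
Proof.
apply: op_comm => //; first exact: (selfadj_cmul cstar_sq).
by exists (nr k); exact: bd_cmul.
Qed.

(** g commutes with multiplication by k, so it is one of the operators with which f, in the
    bicommutant, must commute. *)
Lemma op_commute f g a : f (g a) = g (f a).
Proof.
by apply: op_comm; [exact: op_selfadj|exact: op_bd|exact: op_comm_sq].
Qed.

Lemma op_cmul f a b : f (cmul a b) = cmul (f a) b.
Proof. by rewrite selfadjM//; exact: op_selfadj. Qed.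

Lemma bd_comp f g c d : 0 <= c -> bd f c -> bd g d -> bd (f \o g) (c * d).
Proof.
move=> c0 fc gd a; rewrite (le_trans (fc _))// -mulrA ler_wpM2l//.
Qed.

Lemma op_mul_subproof f g : f \o g \in op_pred x.
Proof.
apply/asboolP; split=> [a b||h hs hc hk a] /=.
- by rewrite op_selfadj op_selfadj op_commute.
- have [[c /bd_gt0[c' c0 fc]] [d gd]] := (op_bd f, op_bd g).
  by exists (c' * d); apply: bd_comp (ltW c0) fc gd.
- by rewrite !(op_comm _ hs hc hk).
Qed.

Definition op_mul f g : op x := MkOp (op_mul_subproof f g).

Lemma op_cst_subproof t : (fun a => t%:C *: a) \in op_pred x.
Proof.
apply/asboolP; split=> [a b||h hs hc hk a] /=.
- by rewrite cstarZr cmulZl cmulZr.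
- by exists `|t| => a; rewrite nrZ.
- have := selfadj_linear hs t%:C a 0.
  by rewrite (selfadj0 hs) !addr0.
Qed.

Definition op_cst t : op x := MkOp (op_cst_subproof t).

Lemma op_mulA : associative op_mul.
Proof. by move=> f g h; apply: op_ext. Qed.

Lemma op_mulC : commutative op_mul.
Proof. by move=> f g; apply: op_ext => a; exact: op_commute. Qed.

Lemma op_mul1 : left_id (op_cst 1) op_mul.
Proof. by move=> f; apply: op_ext => a /=; rewrite scale1r. Qed.

Lemma op_mulDl : left_distributive op_mul +%R.
Proof. by move=> f g h; apply: op_ext. Qed.

(** The structure allows 1 = 0, which happens when A is zero. *)
HB.instance Definition _ := GRing.Zmodule_isComPzRing.Build (op x)
  op_mulA op_mulC op_mul1 op_mulDl.

Lemma op_mulE f g a : (f * g) a = f (g a).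
Proof. by []. Qed.

Lemma op_1E a : (1 : op x) a = a.
Proof. by rewrite -[LHS]/(1%:C *: a) scale1r. Qed.

Lemma op_cst_is_zmod_morphism : zmod_morphism op_cst.
Proof.
by move=> s t; apply: op_ext => a; rewrite op_subE /= rmorphB/= scalerBl.
Qed.

Lemma op_cst_is_monoid_morphism : monoid_morphism op_cst.
Proof.
by split=> // s t; apply: op_ext => a; rewrite op_mulE /= scalerA rmorphM.
Qed.

HB.instance Definition _ := GRing.isZmodMorphism.Build R (op x) op_cst
  op_cst_is_zmod_morphism.
HB.instance Definition _ := GRing.isMonoidMorphism.Build R (op x) op_cst
  op_cst_is_monoid_morphism.

End OpRing.

(** * Norm bounds and completeness of the operator ring *)

Section OpOrder.
Variables (R : realType) (A : cstarAlgType R) (x : A).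
Implicit Types (f g h : op x) (a : A) (c d e t : R).

Notation cst := (op_cst x).

Lemma bdD f g c d : bd f c -> bd g d -> bd (f + g) (c + d).
Proof.
by move=> fc gd a; rewrite op_addE mulrDl (le_trans (nrD _ _))// lerD.
Qed.

Lemma bdB f g c d : bd f c -> bd g d -> bd (f - g) (c + d).
Proof.
by move=> fc gd a; rewrite op_subE mulrDl (le_trans (nrB _ _))// lerD.
Qed.

Lemma bdM f g c d : 0 <= c -> bd f c -> bd g d -> bd (f * g) (c * d).
Proof. exact: bd_comp. Qed.

Lemma bd_cst t : bd (cst t) `|t|.
Proof. by move=> a; rewrite nrZ. Qed.

Lemma bd_cstM t f c : bd f c -> bd (cst t * f) (`|t| * c).
Proof. by move=> fc; apply: bdM => //; exact: bd_cst. Qed.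

Lemma bd1 : bd (1 : op x) 1.
Proof. by move=> a; rewrite op_1E mul1r. Qed.

Lemma bd0 : bd (0 : op x) 0.
Proof. by move=> a; rewrite mul0r -[X in nr X]/(0 : A) nr0. Qed.

Lemma bdX f c n : 0 <= c -> bd f c -> bd (f ^+ n) (c ^+ n).
Proof.
move=> c0 fc; elim: n => [|n IH]; first by rewrite !expr0; exact: bd1.
by rewrite !exprS; apply: bdM.
Qed.

Lemma bd_eq0 f : (forall e, 0 < e -> bd f e) -> f = 0.
Proof.
move=> fe; apply: op_ext => a; rewrite -[RHS]/(0 : A); apply: nr_le_eq0 => e e0.
have a1 : 0 < nr a + 1 by rewrite ltr_wpDl ?nr_ge0.
rewrite (le_trans (fe (e / (nr a + 1)) _ a)) ?divr_gt0//.
by rewrite mulrAC ler_pdivrMr// ler_wpM2l ?(ltW e0)// lerDl.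
Qed.

Lemma bd0_eq0 f : bd f 0 -> f = 0.
Proof. by move=> f0; apply: bd_eq0 => e /ltW; exact: bd_le. Qed.

(* [f + i g] is normal with adjoint [f - i g], so that its square is
   controlled by [f ^+ 2 + g ^+ 2] through the C*-identity. *)
Lemma bd_sqD f g c : 0 <= c -> bd (f ^+ 2 + g ^+ 2) (c ^+ 2) -> bd f c.
Proof.
move=> c0 fg a.
have key (s : R[i]) : s^*%C = - s -> s * s = -1 ->
    nr (f a + s *: g a) <= c * nr a.
  move=> sJ ss; rewrite -(@ler_pXn2r _ 2)// ?nnegrE ?nr_ge0 ?mulr_ge0 ?nr_ge0//.
  rewrite -nr_cstar_cmul.
  have -> : cmul (cstar (f a + s *: g a)) (f a + s *: g a) =
            cmul (cstar a) ((f ^+ 2 + g ^+ 2) a).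
    rewrite cstarD cstarZ sJ !cmulDl !cmulDr !cmulZl !cmulZr.
    rewrite !(@op_selfadj _ _ _ f) !(@op_selfadj _ _ _ g) (op_commute g f).
    rewrite scalerA mulNr ss opprK scale1r.
    by rewrite scaleNr addrACA addrA subrK.
  rewrite (le_trans (nr_cmul _ _))// nr_cstar exprMn.
  rewrite (le_trans (ler_wpM2l (nr_ge0 _) (fg a)))//.
  by rewrite mulrCA expr2 -expr2.
have ip := key 'i%C; have im := key (- 'i%C).
have {}ip : nr (f a + 'i%C *: g a) <= c * nr a.
  by apply: ip; [apply/eqP; rewrite eq_complex/= oppr0 !eqxx|rewrite -expr2 sqr_i].
have {}im : nr (f a - 'i%C *: g a) <= c * nr a.
  rewrite -scaleNr; apply: im; last by rewrite mulrNN -expr2 sqr_i.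
  by apply/eqP; rewrite eq_complex/= !opprK oppr0 !eqxx.
have := le_trans (nrD (f a + 'i%C *: g a) (f a - 'i%C *: g a)) (lerD ip im).
rewrite addrACA subrr addr0.
have -> : f a + f a = 2%:C *: f a.
  by rewrite -[2]/(1 + 1) rmorphD/= scalerDl !scale1r.
rewrite nrZ ger0_norm//; lra.
Qed.

Lemma bd_sq f c : 0 <= c -> bd (f ^+ 2) (c ^+ 2) -> bd f c.
Proof. by move=> c0 fc; apply: (bd_sqD (g := 0)) => //; rewrite expr0n addr0. Qed.

Lemma sq_eq0 f : f ^+ 2 = 0 -> f = 0.
Proof. by move=> f0; apply/bd0_eq0/bd_sq => //; rewrite f0 expr0n; exact: bd0. Qed.

(** Limits exist pointwise by completeness of A. Self-adjointness passes to them by continuity of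
    the product and the star, and commutation with h by boundedness of h. *)
Lemma op_complete (F : nat -> op x) :
  (forall e, 0 < e -> exists N, forall m n, (N <= m <= n)%N -> bd (F n - F m) e) ->
  exists g, forall e, 0 < e -> exists N, forall n, (N <= n)%N -> bd (g - F n) e.
Proof.
move=> Fc.
have Fcvg a : cvgn (fun n => F n a).
  apply: nr_cauchy_cvg => e e0.
  have a1 : 0 < nr a + 1 by rewrite ltr_wpDl ?nr_ge0.
  have [|N FN] := Fc (e / (nr a + 1)); first by rewrite divr_gt0.
  exists N => m n /FN/(_ a); rewrite op_subE => /le_trans; apply.
  by rewrite mulrAC ler_pdivrMr// ler_wpM2l ?(ltW e0)// lerDl.
pose g a := limn (fun n => F n a).
have Fg a : (fun n => F n a) @ \oo --> g a by exact: Fcvg.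
have gF e : 0 < e -> exists N, forall n, (N <= n)%N -> forall a,
    nr (g a - F n a) <= e * nr a.
  move=> e0; have [N FN] := Fc e e0; exists N => n Nn a.
  apply: (@nr_cvg_le _ _ _ _ _ _ n (Fg a)) => m nm.
  by rewrite -op_subE FN// Nn.
have gs : selfadj g.
  move=> a b; apply: (@norm_cvg_unique _ _ (cmul (cstar (F n a)) b @[n --> \oo])).
    exact/cvg_cmulr/cvg_cstar.
  rewrite /=; under eq_fun do rewrite op_selfadj.
  exact: cvg_cmull.
have gP : g \in op_pred x.
  apply/asboolP; split => //.
    have [|N /(_ N (leqnn N)) gN] := gF 1 => //.
    have [c Fc'] := op_bd (F N).
    exists (1 + c) => a; rewrite mulrDl -(subrK (F N a) (g a)).
    by rewrite (le_trans (nrD _ _))// lerD// gN.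
  move=> h hs [c hc] hk a.
  apply: (@norm_cvg_unique _ _ (F n (h a) @[n --> \oo])) => //=.
  under eq_fun do rewrite (op_comm _ hs (ex_intro _ c hc) hk).
  exact: cvg_selfadj hs hc _.
by exists (MkOp gP) => e e0; have [N gN] := gF e e0; exists N => n Nn a; exact: gN.
Qed.

End OpOrder.

(** * Square roots, positive cone and inverses *)

Section OpCalculus.
Variables (R : realType) (A : cstarAlgType R) (x : A).
Implicit Types (f g h p v : op x) (a : A) (c d e t : R).

Notation cst := (op_cst x).

Lemma op_dominated (F : nat -> op x) (s : nat -> R) c :
  (forall n, bd (F n.+1 - F n) (s n.+1 - s n)) ->
  (forall n, s n <= s n.+1) -> (forall n, s n <= c) ->
  exists g : op x, forall e, 0 < e -> exists N, forall n, (N <= n)%N -> bd (g - F n) e.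
Proof.
move=> Fs s_incr s_le; apply: op_complete => e e0.
have [N sN] := nondecreasing_bounded_cauchy s_incr s_le e0.
exists N => m n Nmn; apply: bd_le (sN _ _ Nmn).
case/andP: Nmn => _ mn; rewrite -(subnK mn).
elim: (n - m)%N => [|i IH]; first by rewrite add0n !subrr; exact: bd0.
rewrite addSn.
have -> : F (i + m).+1 - F m = (F (i + m).+1 - F (i + m)%N) + (F (i + m)%N - F m).
  by rewrite addrA subrK.
have -> : s (i + m).+1 - s m = (s (i + m).+1 - s (i + m)%N) + (s (i + m)%N - s m).
  by rewrite addrA subrK.
by apply: bdD.
Qed.

Lemma bd_closed f c : (forall e, 0 < e -> bd f (c + e)) -> bd f c.
Proof.
move=> fe a; apply/ler_addgt0Pr => e e0.
have a1 : 0 < nr a + 1 by rewrite ltr_wpDl ?nr_ge0.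
rewrite (le_trans (fe (e / (nr a + 1)) _ a)) ?divr_gt0//.
rewrite mulrDl lerD2l mulrAC ler_pdivrMr// ler_wpM2l ?(ltW e0)//.
by rewrite lerDl.
Qed.

(* The fixed point s = (v + s^2) / 2 is the limit of an iteration dominated
   by the same iteration at v = 1, which is an increasing sequence in [0, 1]. *)
Lemma op_sqrt1B v : bd v 1 -> exists2 s : op x, bd s 1 & (1 - s) ^+ 2 = 1 - v.
Proof.
move=> v1; pose F := fix F n := if n is m.+1 then cst 2^-1 * (v + F m ^+ 2) else 0.
pose s := fix s n := if n is m.+1 then 2^-1 * (1 + s m ^+ 2) else 0 : R.
have s01 n : 0 <= s n <= 1.
  elim: n => [|n /andP[s0 s1]] /=; first by rewrite lexx ler01.
  by apply/andP; split; nra.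
have s_incr n : s n <= s n.+1 by have := s01 n => /=; nra.
have Fs n : bd (F n) (s n).
  elim: n => [|n IH]; first exact: bd0.
  rewrite -[F _]/(cst 2^-1 * (v + F n ^+ 2)) -[s _]/(2^-1 * (1 + s n ^+ 2)).
  rewrite -{2}[2^-1]ger0_norm; last by rewrite invr_ge0 ler0n.
  apply: bd_cstM; apply: bdD => //.
  by apply: bdX => //; have /andP[] := s01 n.
have FsB n : bd (F n.+1 - F n) (s n.+1 - s n).
  elim: n => [|n IH]; first by rewrite /s !subr0; exact: Fs.
  have -> : F n.+2 - F n.+1 = cst 2^-1 * ((F n.+1 + F n) * (F n.+1 - F n)).
    rewrite -[F n.+2]/(cst 2^-1 * (v + F n.+1 ^+ 2)).
    by rewrite -[F n.+1 in X in _ - X]/(cst 2^-1 * (v + F n ^+ 2)); ring.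
  have -> : s n.+2 - s n.+1 = 2^-1 * ((s n.+1 + s n) * (s n.+1 - s n)).
    rewrite -[s n.+2]/(2^-1 * (1 + s n.+1 ^+ 2)).
    by rewrite -[s n.+1 in X in _ - X]/(2^-1 * (1 + s n ^+ 2)); ring.
  rewrite -{2}[2^-1]ger0_norm; last by rewrite invr_ge0 ler0n.
  apply: bd_cstM; apply: bdM => //; last exact: bdD.
  by rewrite addr_ge0//; [have /andP[] := s01 n.+1|have /andP[] := s01 n].
have [|g gF] := op_dominated FsB s_incr (c := 1).
  by move=> n; have /andP[] := s01 n.
have F1 n : bd (F n) 1 by apply: bd_le (Fs n) _; have /andP[] := s01 n.
have g1 : bd g 1.
  apply: bd_closed => e /gF[N /(_ N (leqnn N)) gN].
  by rewrite -(subrK (F N) g) addrC; apply: bdD.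
exists g => //.
have half : cst 2^-1 * 2 = 1.
  by rewrite -(rmorph_nat cst 2) -rmorphM/= mulVf ?rmorph1 ?pnatr_eq0.
(* Completing the square turns the fixed point equation into the claim. *)
suff E : g = cst 2^-1 * (v + g ^+ 2).
  have E2 : 2 * g = v + g ^+ 2 by rewrite {1}E mulrA (mulrC 2) half mul1r.
  have -> : (1 - g) ^+ 2 = 1 - 2 * g + g ^+ 2 by ring.
  by rewrite E2; ring.
apply/eqP; rewrite -subr_eq0; apply/eqP/bd_eq0 => e e0.
have [|N gN] := gF (e / 2); first by rewrite divr_gt0.
have -> : g - cst 2^-1 * (v + g ^+ 2) =
    (g - F N.+1) - cst 2^-1 * ((g + F N) * (g - F N)).
  by rewrite -[F N.+1]/(cst 2^-1 * (v + F N ^+ 2)); ring.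
have -> : e = e / 2 + `|2^-1| * ((1 + 1) * (e / 2)).
  by rewrite ger0_norm ?invr_ge0//; lra.
apply: bdB; first by apply: gN; exact: leqnSn.
by apply: bd_cstM; apply: bdM => //; [exact: bdD|exact: gN].
Qed.

(** Positivity without spectrum: g ranges over self-adjoint operators of the same commutative ring.
    That sums stay positive is the nontrivial part. *)
Definition pos f := exists g, f = g ^+ 2.

Lemma pos_sq f : pos (f ^+ 2).
Proof. by exists f. Qed.

Lemma posM f g : pos f -> pos g -> pos (f * g).
Proof. by move=> [f' ->] [g' ->]; exists (f' * g'); rewrite exprMn. Qed.

Lemma pos_cst c : 0 <= c -> pos (cst c).
Proof. by move=> c0; exists (cst (Num.sqrt c)); rewrite -rmorphXn/= sqr_sqrtr. Qed.

Lemma bd1_of_sqD1 f g : f ^+ 2 + g ^+ 2 = 1 -> bd f 1.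
Proof.
by move=> fg; apply: (bd_sqD (g := g)) => //; rewrite fg expr1n; exact: bd1.
Qed.

(** If f = g^2, a square root h of 1 - f satisfies g^2 + h^2 = 1, hence is a contraction. Together
    with [bd1B_pos] this makes positivity of a contraction a norm condition. *)
Lemma pos_bd1B f : pos f -> bd f 1 -> bd (1 - f) 1.
Proof.
move=> [g ->] g1; have [s _ sE] := op_sqrt1B g1.
rewrite -sE; have := @bdX _ _ _ (1 - s) 1 2 ler01; rewrite expr1n; apply.
by apply: (bd1_of_sqD1 (g := g)); rewrite sE subrK.
Qed.

Lemma bd1B_pos f : bd (1 - f) 1 -> pos f.
Proof.
move=> f1; have [s _ sE] := op_sqrt1B f1; exists (1 - s).
by rewrite sE opprB addrCA subrr addr0.
Qed.

Lemma cst_cancel c f : c != 0 -> cst c * (cst c^-1 * f) = f.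
Proof. by move=> c0; rewrite mulrA -rmorphM/= divff// rmorph1 mul1r. Qed.

(** The criterion [bd (1 - f) 1] is convex: after division by a common bound K, the mean of the two
    operators satisfies it. *)
Lemma posD f g : pos f -> pos g -> pos (f + g).
Proof.
move=> fp gp.
have [[c /bd_gt0[c' c0 fc]] [d /bd_gt0[d' d0 gd]]] := (op_bd f, op_bd g).
pose K := (c' + d'); have K0 : 0 < K by rewrite addr_gt0.
have scale h b : pos h -> bd h b -> 0 < b -> b <= K ->
    bd (1 - cst K^-1 * h) 1.
  move=> hp hb b0 bK; apply: pos_bd1B.
    by apply: posM => //; apply: pos_cst; rewrite invr_ge0 ltW.
  apply: bd_le (bd_cstM _ hb) _.
  by rewrite ger0_norm ?invr_ge0 ?(ltW K0)// ler_pdivrMl// mulr1.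
suff /bd1B_pos fgp : bd (1 - cst (2 * K)^-1 * (f + g)) 1.
  rewrite -(@cst_cancel (2 * K) (f + g)) ?gt_eqF ?mulr_gt0//.
  by apply: posM => //; apply: pos_cst; rewrite mulr_ge0 ?(ltW K0).
have half : cst 2^-1 + cst 2^-1 = 1.
  by rewrite -rmorphD/= -(rmorph1 cst); congr (cst _); lra.
have -> : 1 - cst (2 * K)^-1 * (f + g) =
    cst 2^-1 * ((1 - cst K^-1 * f) + (1 - cst K^-1 * g)).
  rewrite invfM rmorphM/=; move: (cst 2^-1) (cst K^-1) half => a b ab.
  by transitivity ((a + a) - a * b * (f + g)); [rewrite ab|ring].
have fb : bd (1 - cst K^-1 * f) 1 by apply: scale fp fc _ _ => //; rewrite /K lerDl ltW.
have gb : bd (1 - cst K^-1 * g) 1 by apply: scale gp gd _ _ => //; rewrite /K lerDr ltW.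
apply: bd_le (bd_cstM 2^-1 (bdD fb gb)) _.
by rewrite ger0_norm ?invr_ge0//; lra.
Qed.

Lemma pos_bd f c : 0 < c -> pos f -> pos (cst c - f) -> bd f c.
Proof.
move=> c0 [g fE] [h hE]; pose r := Num.sqrt c.
have r0 : 0 < r by rewrite sqrtr_gt0.
have rr : r ^+ 2 = c by rewrite sqr_sqrtr// ltW.
rewrite fE -rr; apply: bdX; first exact: ltW.
apply: (bd_sqD (g := h)); first exact: ltW.
by rewrite -fE -hE addrC subrK rr -{2}(gtr0_norm c0); exact: bd_cst.
Qed.

Lemma pos_antisym f : pos f -> pos (- f) -> f = 0.
Proof.
move=> [g ->] [h hE]; suff -> : g = 0 by rewrite expr0n.
apply/bd0_eq0/(bd_sqD (g := h)) => //.
by rewrite -hE subrr expr0n; exact: bd0.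
Qed.

(** The absolute value of f. Scaled to norm at most 1, f^2 has a square root 1 - s with s a
    contraction, and this makes 1 - s positive. *)
Lemma pos_sqrt_sq f : exists2 g : op x, pos g & g ^+ 2 = f ^+ 2.
Proof.
have [c /bd_gt0[K K0 fK]] := op_bd f.
have f1 : bd (cst K^-1 * f) 1.
  apply: bd_le (bd_cstM _ fK) _.
  by rewrite ger0_norm ?invr_ge0 ?(ltW K0)// mulVf ?gt_eqF.
have f2 : bd ((cst K^-1 * f) ^+ 2) 1 by have := bdX 2 ler01 f1; rewrite expr1n.
have [s s1 sE] := op_sqrt1B (pos_bd1B (pos_sq _) f2).
exists (cst K * (1 - s)).
  apply: posM; first exact/pos_cst/ltW.
  by apply: bd1B_pos; rewrite subKr.
by rewrite exprMn sE subKr -exprMn cst_cancel ?gt_eqF.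
Qed.

(* For the absolute value g of c + f, the difference D = g - (c + f)
   satisfies D^2 g = - 2 c D^2, so that both sides vanish, and then
   D^3 = - 4 c D^2 = 0. *)
Lemma pos_absD (c f : op x) : pos c -> c ^+ 2 = f ^+ 2 -> pos (c + f).
Proof.
move=> cp cf; pose p := c + f; have [g gp gE] := pos_sqrt_sq p.
have pE : p ^+ 2 - 2 * c * p = 0.
  transitivity (f ^+ 2 - c ^+ 2); [by rewrite /p; ring|by rewrite cf subrr].
have gE0 : g ^+ 2 - p ^+ 2 = 0 by rewrite gE subrr.
pose D := g - p.
have D2 : D ^+ 2 * g = - (c * D ^+ 2 + c * D ^+ 2).
  apply/eqP; rewrite -subr_eq0; apply/eqP.
  (* A certificate of membership in the ideal generated by [g ^+ 2 - p ^+ 2] and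
     [p ^+ 2 - 2 * c * p], both zero. The identity for [D ^+ 3] below has [c * D ^+ 2] as a third
     generator. *)
  transitivity ((g ^+ 2 - p ^+ 2) * (g - 2 * p + 2 * c) + 2 * (p ^+ 2 - 2 * c * p) * D).
    by rewrite /D; ring.
  by rewrite gE0 pE; ring.
have cD : c * D ^+ 2 = 0.
  have cDp : pos (c * D ^+ 2) by apply: posM => //; exact: pos_sq.
  apply: pos_antisym => //.
  have -> : - (c * D ^+ 2) = D ^+ 2 * g + c * D ^+ 2 by rewrite D2; ring.
  by apply: posD => //; apply: posM => //; exact: pos_sq.
have D3 : D ^+ 3 = 0.
  transitivity ((g ^+ 2 - p ^+ 2) * (D - 2 * p + 4 * c) +
      4 * (p ^+ 2 - 2 * c * p) * D - 4 * (c * D ^+ 2)).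
    by rewrite /D; ring.
  by rewrite gE0 pE cD; ring.
have D0 : D = 0 by apply/sq_eq0/sq_eq0; rewrite -exprM exprSr D3 mul0r.
by have -> : c + f = g by apply/esym/eqP; rewrite -subr_eq0; apply/eqP.
Qed.

(** Partial sums of the Neumann series in Horner form, dominated by those of the geometric series of
    ratio c. *)
Lemma op_neumann v c : 0 <= c < 1 -> bd v c -> exists g : op x, (1 - v) * g = 1.
Proof.
move=> /andP[c0 c1] vc; pose F := fix F n := if n is m.+1 then 1 + v * F m else 0.
pose s := fix s n := if n is m.+1 then 1 + c * s m else 0 : R.
have s_incr n : 0 <= s n <= s n.+1.
  elim: n => [|n /andP[s0 s1]]; first by rewrite /= mulr0 addr0 lexx ler01.
  apply/andP; split; first exact: le_trans s0 s1.
  rewrite -[leRHS]/(1 + c * s n.+1).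
  by rewrite -[leLHS]/(1 + c * s n) lerD2l ler_wpM2l.
have s_le n : s n <= (1 - c)^-1.
  elim: n => [|n IH]; first by rewrite /= invr_ge0; lra.
  have c' : 1 - c != 0 by rewrite gt_eqF// subr_gt0.
  have -> : (1 - c)^-1 = 1 + c * (1 - c)^-1 by field.
  by rewrite /= lerD2l ler_wpM2l.
have FsB n : bd (F n.+1 - F n) (s n.+1 - s n).
  elim: n => [|n IH].
    rewrite -[F 1]/(1 + v * 0) -[s 1]/(1 + c * 0) -[F 0]/(0 : op x) -[s 0]/(0 : R).
    by rewrite !mulr0 !addr0 !subr0; exact: bd1.
  have -> : F n.+2 - F n.+1 = v * (F n.+1 - F n).
    rewrite -[F n.+2]/(1 + v * F n.+1).
    by rewrite -[F n.+1 in X in _ - X]/(1 + v * F n); ring.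
  have -> : s n.+2 - s n.+1 = c * (s n.+1 - s n).
    rewrite -[s n.+2]/(1 + c * s n.+1).
    by rewrite -[s n.+1 in X in _ - X]/(1 + c * s n); ring.
  exact: bdM.
have [|g gF] := op_dominated FsB _ s_le.
  by move=> n; have /andP[] := s_incr n.
exists g; apply/eqP; rewrite -subr_eq0; apply/eqP/bd_eq0 => e e0.
have [|N gN] := gF (e / 2); first by rewrite divr_gt0.
have -> : (1 - v) * g - 1 = (g - F N.+1) - v * (g - F N).
  by rewrite -[F N.+1]/(1 + v * F N); ring.
apply: (@bd_le _ _ _ (e / 2 + c * (e / 2))); last by nra.
apply: bdB; first by apply: gN; exact: leqnSn.
by apply: bdM => //; exact: gN.
Qed.

(** With K above the norm of f, v = 1 - f / K lies between 0 and 1 - d / K < 1. The inverse g' is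
    positive because g' = f g'^2. *)
Lemma op_inv f d : 0 < d -> pos (f - cst d) -> exists2 g : op x, pos g & f * g = 1.
Proof.
move=> d0 fd.
have fp : pos f by rewrite -(subrK (cst d) f); apply: posD => //; exact/pos_cst/ltW.
have [c /bd_gt0[c' c0 fc]] := op_bd f.
pose K := c' + d; have K0 : 0 < K by rewrite addr_gt0.
have cK : c' / K < 1 by rewrite ltr_pdivrMr// mul1r /K ltrDl.
have dK : 0 < d / K < 1.
  by rewrite divr_gt0//= ltr_pdivrMr// mul1r /K ltrDr.
have KV : 0 <= K^-1 by rewrite invr_ge0 ltW.
pose v := 1 - cst K^-1 * f.
have vp : pos v.
  apply: bd1B_pos; rewrite /v subKr; apply: bd_le (bd_cstM _ fc) _.
  by rewrite ger0_norm// mulrC ltW.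
have vd : bd v (1 - d / K).
  apply: pos_bd => //; first by case/andP: dK => _; rewrite subr_gt0.
  have -> : cst (1 - d / K) - v = cst K^-1 * (f - cst d).
    by rewrite /v rmorphB rmorphM rmorph1/=; ring.
  by apply: posM => //; exact: pos_cst.
have [|g] := op_neumann _ vd; first by lra.
rewrite /v subKr => gE; pose g' := cst K^-1 * g.
have fg : f * g' = 1 by rewrite -gE /g'; ring.
exists g' => //.
have -> : g' = f * g' ^+ 2 by rewrite expr2 mulrA fg mul1r.
by apply: posM => //; exact: pos_sq.
Qed.

End OpCalculus.

(** * Cutoffs *)

Section OpCutoffs.
Variables (R : realType) (A : cstarAlgType R) (x : A).
Implicit Types (f g : op x) (e : R).

Notation cst := (op_cst x).

(** Positive and negative parts (|f| + f) / 2 and (|f| - f) / 2; their product is (|f|^2 - f^2) /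
    4. *)
Lemma op_parts f : exists pn : op x * op x,
  [/\ pos pn.1, pos pn.2, pn.1 * pn.2 = 0 & pn.1 - pn.2 = f].
Proof.
have [c cp cE] := pos_sqrt_sq f.
have hp : pos (cst 2^-1) by apply: pos_cst; rewrite invr_ge0.
have half : cst 2^-1 * 2 = 1.
  by rewrite -(rmorph_nat cst 2) -rmorphM/= mulVf ?rmorph1 ?pnatr_eq0.
exists (cst 2^-1 * (c + f), cst 2^-1 * (c - f)); split => /=.
- by apply: posM => //; exact: pos_absD.
- by apply: posM => //; apply: pos_absD => //; rewrite sqrrN.
- transitivity (cst 2^-1 ^+ 2 * (c ^+ 2 - f ^+ 2)); first by ring.
  by rewrite cE subrr mulr0.
- by transitivity (cst 2^-1 * 2 * f); [ring|rewrite half mul1r].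
Qed.

Lemma pos_bd1 f : pos f -> pos (1 - f) -> bd f 1.
Proof. by move=> fp f1; apply: pos_bd => //; rewrite rmorph1. Qed.

(** With e_j = 1 / (j + 1) and p_j, n_j the parts of m - e_j, put r_j = p_(j+1) / (p_(j+1) + n_j).
    As a function of m it rises from 0 at e_(j+1) to 1 at e_j, and its denominator is at least e_j -
    e_(j+1), so it can be inverted. *)
Lemma op_cutoffs (m : op x) : pos m -> exists r q : nat -> op x,
  [/\ forall j, pos (r j) /\ pos (1 - r j),
      forall j, r j = m * q j,
      forall j, r j * r j.+1 = r j &
      forall j, bd (m * (1 - r j)) j.+1%:R^-1].
Proof.
move=> mp; pose e j : R := j.+1%:R^-1.
have e0 j : 0 < e j by rewrite invr_gt0.
have eS j : e j.+1 < e j by rewrite ltf_pV2 ?posrE// ltr_nat.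
have /choice[pn pnP] := fun j => op_parts (m - cst (e j)).
pose p j := (pn j).1; pose n j := (pn j).2.
have pp j : pos (p j) by have [] := pnP j.
have np j : pos (n j) by have [] := pnP j.
have pn0 j : p j * n j = 0 by have [] := pnP j.
have pnB j : p j = n j + (m - cst (e j)) by have [_ _ _ <-] := pnP j; rewrite addrC subrK.
pose z j := p j.+1 + n j.
have zp j : pos (z j - cst (e j - e j.+1)).
  have -> : z j - cst (e j - e j.+1) = n j.+1 + p j.
    by rewrite /z (pnB j.+1) (pnB j) rmorphB/=; ring.
  exact: posD.
have /choice[w wP] : forall j, exists w, pos w /\ z j * w = 1.
  by move=> j; have [|w wp wz] := op_inv _ (zp j); [rewrite subr_gt0|exists w].
have wp j : pos (w j) by have [] := wP j.
have zw j : z j * w j = 1 by have [] := wP j.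
have /choice[v vP] : forall j, exists v, (p j + cst (e j)) * v = 1.
  move=> j; have [|v _ vE] := @op_inv _ _ _ (p j + cst (e j)) _ (e0 j).
    by rewrite addrK.
  by exists v.
pose r j := p j.+1 * w j.
have rB j : 1 - r j = n j * w j by rewrite -(zw j) /r /z; ring.
exists r, (fun j => p j.+1 * v j.+1 * w j); split=> j.
- by rewrite rB; split; apply: posM.
(* Against p_(j+1), m acts as the invertible operator p_(j+1) + e_(j+1); hence m divides p_(j+1). *)
- have pE : p j.+1 * (p j.+1 + cst (e j.+1)) = m * p j.+1.
    apply/eqP; rewrite -subr_eq0; apply/eqP.
    transitivity (p j.+1 * (p j.+1 - (n j.+1 + (m - cst (e j.+1)))) + p j.+1 * n j.+1).
      by ring.
    by rewrite -pnB pn0; ring.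
  transitivity (p j.+1 * ((p j.+1 + cst (e j.+1)) * v j.+1) * w j).
    by rewrite vP mulr1.
  transitivity ((p j.+1 * (p j.+1 + cst (e j.+1))) * v j.+1 * w j); first by ring.
  by rewrite pE; ring.
- apply/eqP; rewrite -subr_eq0; apply/eqP.
  transitivity (- (r j * (1 - r j.+1))); first by ring.
  rewrite rB /r; transitivity (- (p j.+1 * n j.+1 * w j * w j.+1)); first by ring.
  by rewrite pn0; ring.
- apply: pos_bd => //; first by rewrite rB; apply: posM => //; exact: posM.
  have -> : cst j.+1%:R^-1 - m * (1 - r j) =
      cst (e j) * r j + n j ^+ 2 * w j.
    rewrite -/(e j).
    transitivity (cst (e j) * r j - (m - cst (e j)) * (1 - r j)); first by ring.
    rewrite rB; have -> : m - cst (e j) = p j - n j by rewrite pnB; ring.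
    transitivity (cst (e j) * r j + n j ^+ 2 * w j - p j * n j * w j); first by ring.
    by rewrite pn0; ring.
  by apply: posD; apply: posM => //; [exact/pos_cst/ltW|exact: posM|exact: pos_sq].
Qed.

End OpCutoffs.

(** * From operators back to elements of the algebra *)

Section Cutoffs.
Variables (R : realType) (A : cstarAlgType R) (x : A).

Let k := cmul (cstar x) x.

Lemma op_sq_subproof : cmul k \in op_pred x.
Proof.
apply/asboolP; split.
- exact/selfadj_cmul/cstar_sq.
- by exists (nr k); exact: bd_cmul.
- by move=> g _ _ gk a; rewrite gk.
Qed.

Definition op_sq : op x := MkOp op_sq_subproof.

Lemma nr_cmul_cstar (a : A) : nr (cmul a (cstar a)) = nr a ^+ 2.
Proof. by rewrite -{1}(cstarK a) nr_cstar_cmul nr_cstar. Qed.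

Lemma bd_cmul_le (a : A) c : 0 <= c -> bd (cmul a) c -> nr a <= c.
Proof.
move=> c0 /(_ (cstar a)); rewrite nr_cmul_cstar nr_cstar expr2.
have [->//|a0] := eqVneq (nr a) 0.
by rewrite ler_pM2r// lt_def a0 nr_ge0.
Qed.

(** The operator inequality r^2 <= 1 is brought into A: with 1 - r^2 = (1 - s)^2, the difference is
    the square of (1 - s) c. It will make the squares of the cutoffs an increasing net. *)
Lemma cpositive_sub (r : op x) (c : A) : bd r 1 ->
  cpositive (cmul (cstar c) c - cmul (cstar c) (r (r c))).
Proof.
move=> r1; have r2 : bd (r ^+ 2) 1 by have := bdX 2 ler01 r1; rewrite expr1n.
have [s _ sE] := op_sqrt1B r2; exists ((1 - s) c).
by rewrite (@op_selfadj _ _ _ (1 - s)) -!op_mulE -!expr2 sE -cmulBr op_subE op_1E.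
Qed.

(** The increments of r_j^2 are positive with sum at most 1, so a combination S with coefficients in
    [-1, 1] lies between -1 and 1. Positivity of (1 - S)(1 + S) then bounds S. This is what yields
    bounded variation under functionals. *)
Lemma op_telescope_bd (r : nat -> op x) (th : nat -> R) N :
  (forall j, pos (r j) /\ pos (1 - r j)) -> (forall j, r j * r j.+1 = r j) ->
  (forall j, -1 <= th j <= 1) ->
  bd (\sum_(j < N) op_cst x (th j) * (r j.+1 ^+ 2 - r j ^+ 2)) 1.
Proof.
move=> rp rr th1.
have r2p j : pos (1 - r j ^+ 2).
  have [rjp rj1] := rp j.
  have -> : 1 - r j ^+ 2 = (1 - r j) * (1 + r j) by ring.
  by apply: posM => //; apply: posD => //; rewrite -(rmorph1 (op_cst x)); exact: pos_cst.
have dp j : pos (r j.+1 ^+ 2 - r j ^+ 2).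
  have -> : r j.+1 ^+ 2 - r j ^+ 2 = r j.+1 ^+ 2 * (1 - r j ^+ 2).
    rewrite mulrBr mulr1 -exprMn [r j.+1 * _]mulrC rr//.
  by apply: posM => //; exact: pos_sq.
have key (s : nat -> R) : (forall j, -1 <= s j <= 1) ->
    pos (1 - \sum_(j < N) op_cst x (s j) * (r j.+1 ^+ 2 - r j ^+ 2)).
  move=> s1.
  have : pos (r N ^+ 2 - \sum_(j < N) op_cst x (s j) * (r j.+1 ^+ 2 - r j ^+ 2)).
    elim: N => [|M IH]; first by rewrite big_ord0 subr0; exact: pos_sq.
    rewrite big_ord_recr/=.
    set S := \sum_(j < M) _ in IH *.
    have -> : r M.+1 ^+ 2 - (S + op_cst x (s M) * (r M.+1 ^+ 2 - r M ^+ 2)) =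
        (r M ^+ 2 - S) + op_cst x (1 - s M) * (r M.+1 ^+ 2 - r M ^+ 2).
      by rewrite rmorphB rmorph1/=; ring.
    apply: posD => //; apply: posM => //; apply: pos_cst.
    by rewrite subr_ge0; have /andP[] := s1 M.
  move=> /posD/(_ (r2p N)); set S := \sum_(j < N) _.
  by have -> : r N ^+ 2 - S + (1 - r N ^+ 2) = 1 - S by ring.
set S := \sum_(j < N) _.
have : pos ((1 - S) * (1 + S)).
  apply: posM; first exact: key.
  have := key (fun j => - th j).
  rewrite (eq_bigr (fun j : 'I_N => - (op_cst x (th j) * (r j.+1 ^+ 2 - r j ^+ 2)))).
    by rewrite sumrN opprK; apply => j; rewrite lerN2 lerNl andbC; exact: th1.
  by move=> j _; rewrite rmorphN mulNr.
move=> [g gE]; apply: (bd1_of_sqD1 (g := g)).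
by rewrite -gE; ring.
Qed.

(** The factors b_j put r_j in the left ideal generated by x; the positivity clause gives
    monotonicity of r_j^2 and the last clause its weak convergence. *)
Lemma exists_cutoffs : exists r b : nat -> A,
  [/\ forall j, cstar (r j) = r j,
      forall j, cmul (r j) (r j.+1) = r j,
      forall j, r j = cmul (b j) k &
      forall j, nr (r j) <= 1] /\
  [/\ (fun j => cmul x (r j)) @ \oo --> x,
      forall j c, cpositive
        (cmul (cstar c) c - cmul (cstar c) (cmul (r j) (cmul (r j) c))) &
      forall (th : nat -> R) N, (forall j, -1 <= th j <= 1) ->
        nr (\sum_(j < N) (th j)%:C *:
          (cmul (r j.+1) (r j.+1) - cmul (r j) (r j))) <= 1].
Proof.
pose t := (nr k ^+ 2 + 1)^-1.
have kt : 0 < nr k ^+ 2 + 1 by rewrite ltr_wpDl ?sqr_ge0.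
have t0 : 0 < t by rewrite invr_gt0.
(* The square of k is positive by definition, whereas positivity of k would need an argument. *)
pose m : op x := op_cst x t * op_sq ^+ 2.
have mp : pos m by apply: posM; [exact/pos_cst/ltW|exact: pos_sq].
have [r [q [rp rm rr mr]]] := op_cutoffs mp.
have r1 j : bd (r j) 1 by have [? ?] := rp j; exact: pos_bd1.
(* Since r_j = m q_j and m is multiplication by t k^2, the operator r_j is multiplication by an
   element of A. *)
pose b j := q j (t%:C *: k); pose s j := cmul (b j) k.
have rs j a : r j a = cmul (s j) a.
  transitivity (q j (cmul (cmul (t%:C *: k) k) a)); last by rewrite !op_cmul.
  rewrite rm mulrC op_mulE; congr (q j _).
  by rewrite -[LHS]/(t%:C *: cmul k (cmul k a)) !cmulZl cmulA.
have s_star j : cstar (s j) = s j.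
  apply: cmul_nondegr => a; apply: cmul_nondeg => c.
  by rewrite cmulA -cstarM -!rs op_selfadj.
have s1 j : nr (s j) <= 1.
  by apply: bd_cmul_le => // a; rewrite -rs; exact: r1.
exists s, b; split; split => //.
- by move=> j; apply: cmul_nondegr => a; rewrite -cmulA -!rs -op_mulE rr.
- apply/cvg_nrP => e e0.
  (* The square of k (1 - r_j) is m (1 - r_j)^2 / t, of norm at most 1 / (t (j + 1)), so E = k - k
     s_j has norm at most e^2 / 2. The squared norm of x - x s_j is that of E - s_j E, hence at most
     e^2. *)
  pose d := t * (e ^+ 2 / 2) ^+ 2.
  have d0 : 0 < d by rewrite mulr_gt0// exprn_gt0// divr_gt0// exprn_gt0.
  have [N Nd] : exists N : nat, N.+1%:R^-1 <= d.
    exists (Num.truncn d^-1); rewrite invf_ple ?posrE//.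
    exact/ltW/truncnS_gt.
  exists N => j Nj; pose E := k - cmul k (s j).
  have Ed : nr E <= e ^+ 2 / 2.
    have e2 : 0 <= e ^+ 2 / 2 by rewrite divr_ge0// sqr_ge0.
    apply: bd_cmul_le => //.
    have -> : cmul E = op_sq * (1 - r j) :> (A -> A).
      apply/funext => a.
      by rewrite op_mulE op_subE op_1E rs /E cmulBl -cmulA -cmulBr.
    apply: bd_sq => //.
    have -> : (op_sq * (1 - r j)) ^+ 2 = op_cst x t^-1 * (m * (1 - r j) * (1 - r j)).
      rewrite /m; transitivity (op_cst x t^-1 * (op_cst x t * (op_sq * (1 - r j)) ^+ 2)).
        by rewrite mulrA -rmorphM/= mulVf ?gt_eqF// rmorph1 mul1r.
      by congr (_ * _); ring.
    have rB : bd (1 - r j) 1 by have [? ?] := rp j; exact: pos_bd1B.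
    apply: bd_le (bd_cstM t^-1 (bdM _ (mr j) rB)) _; first by rewrite invr_ge0.
    have tV : 0 <= t^-1 by rewrite invr_ge0 ltW.
    rewrite mulr1 ger0_norm//.
    rewrite [leLHS](mulrC t^-1 j.+1%:R^-1) ler_pdivrMr// [leRHS]mulrC.
    by apply: le_trans Nd; rewrite lef_pV2 ?posrE// ler_nat ltnS.
  rewrite -(@ler_pXn2r _ 2)// ?nnegrE ?nr_ge0 ?(ltW e0)//.
  rewrite -nr_cstar_cmul cstarB cstarM s_star.
  have -> : cmul (cstar x - cmul (s j) (cstar x)) (x - cmul x (s j)) = E - cmul (s j) E.
    by rewrite cmulBl -cmulA cmulBr cmulA.
  rewrite (le_trans (nrB _ _))//.
  have := nr_cmul (s j) E; have := s1 j; have := nr_ge0 E; have := nr_ge0 (s j).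
  nra.
- move=> j c; rewrite -!rs; exact: cpositive_sub.
- move=> th N th1; apply: bd_cmul_le => //.
  have := op_telescope_bd N rp rr th1.
  set S := \sum_(j < N) _; set S' := \sum_(j < N) _.
  suff -> : S = cmul S' :> (A -> A) by [].
  apply/funext => a.
  rewrite (big_morph (cmul^~ a) (fun u v => cmulDl u v a) (cmul0l a)).
  rewrite (big_morph (fun f : op x => f a) (fun f g => op_addE f g a) erefl).
  apply: eq_bigr => j _.
  by rewrite op_mulE op_subE !expr2 !op_mulE !rs cmulZl cmulBl !cmulA.
Qed.

End Cutoffs.

Lemma cutoff_mul (R : realType) (A : cstarAlgType R) (r : nat -> A) :
  (forall j, cstar (r j) = r j) ->
  (forall j, cmul (r j) (r j.+1) = r j) -> forall m n, (m < n)%N ->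
  cmul (r m) (r n) = r m /\ cmul (r n) (r m) = r m.
Proof.
move=> rs rr m n mn; have rmn : cmul (r m) (r n) = r m.
  elim: n mn => // n IH; rewrite ltnS leq_eqVlt => /predU1P[->//|/IH mn].
  by rewrite -{1}mn -cmulA rr mn.
by split=> //; rewrite -{1}(rs n) -{1}(rs m) -cstarM rmn rs.
Qed.

(** * Range projections in the bidual *)

Section WeakLimits.
Variables (R : realType) (A : cstarAlgType R).
Implicit Types (a b : A) (f : dual A) (F G H : bidual A).

Lemma bmulA F G H : bmul (bmul F G) H = bmul F (bmul G H).
Proof.
apply: dual_ext => f; rewrite /=; congr (F _); apply: dual_ext => a /=.
by congr (G _); apply: dual_ext => b /=; congr (H _); apply: dual_ext => c /=;
  rewrite cmulA.
Qed.

Lemma bmulBl F G H : bmul (F - G) H = bmul F H - bmul G H.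
Proof. exact: dual_ext. Qed.

Lemma bmulBr F G H : bmul F (G - H) = bmul F G - bmul F H.
Proof.
apply: dual_ext => f; rewrite dualBE /= -raddfB; congr (F _).
exact: dual_ext.
Qed.

Lemma bstarB F G : bstar (F - G) = bstar F - bstar G.
Proof. by apply: dual_ext => f; rewrite dualBE /= rmorphB. Qed.

Lemma embedB a b : embed (a - b) = embed a - embed b.
Proof. by apply: dual_ext => f; rewrite dualBE /= raddfB. Qed.

Lemma nr_dual (V : normedModType R[i]) (f : dual V) (v : V) :
  nr (f v : R[i]^o) <= nr f * nr v.
Proof. by rewrite -lecR rmorphM/= -!nrE; exact: dual_normP. Qed.

Lemma cvg_dual (V : normedModType R[i]) (f : dual V) (u : nat -> V) (l : V) :
  u @ \oo --> l -> (f (u n) : R[i]^o) @[n --> \oo] --> (f l : R[i]^o).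
Proof.
by apply: cvg_bounded_additive => [x y|x]; [rewrite raddfB|exact: nr_dual].
Qed.

Lemma real_bounded_variation_cvg (a : nat -> R) (c : R) :
  (forall N, \sum_(j < N) `|a j.+1 - a j| <= c) -> cvgn a.
Proof.
move=> ac; pose s n := \sum_(j < n) `|a j.+1 - a j|.
have sS n : s n.+1 = s n + `|a n.+1 - a n| by rewrite /s big_ord_recr.
have s_incr n : s n <= s n.+1 by rewrite sS lerDl.
apply/cauchy_cvgP/cauchyP => e e0.
have [|N sN] := nondecreasing_bounded_cauchy s_incr ac (e := e / 2).
  by rewrite divr_gt0.
exists (a N); exists N => // n /= Nn; rewrite -ball_normE /= distrC.
apply: (@le_lt_trans _ _ (e / 2)); last by rewrite ltr_pdivrMr// ltr_pMr ?ltr1n.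
apply: le_trans (sN N n _); last by rewrite leqnn.
rewrite -(subnK Nn); elim: (n - N)%N => [|i IH]; first by rewrite !subrr normr0.
rewrite addSn sS [leRHS]addrAC.
rewrite (_ : a _ - a N = (a (i + N)%N - a N) + (a (i + N).+1 - a (i + N)%N)).
  by rewrite (le_trans (ler_normD _ _))// lerD2r.
by rewrite [RHS]addrC addrA subrK.
Qed.

(** With [th] the signs of the increments of Re f(u_j), the signed sum becomes their total
    variation. *)
Lemma dual_bounded_variation_Re (u : nat -> A) (c : R) f :
  (forall (th : nat -> R) N, (forall j, -1 <= th j <= 1) ->
     nr (\sum_(j < N) (th j)%:C *: (u j.+1 - u j)) <= c) ->
  cvgn (fun n => complex.Re (f (u n))).
Proof.
move=> uc; apply: (@real_bounded_variation_cvg _ (nr f * c)) => N.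
pose th j := Num.sg (complex.Re (f (u j.+1)) - complex.Re (f (u j))).
have th1 j : -1 <= th j <= 1.
  by rewrite -ler_norml /th normr_sg; case: (_ != 0).
have := ler_wpM2l (nr_ge0 f) (uc th N th1); apply: le_trans.
apply: le_trans (nr_dual _ _).
rewrite -lecR -nrE; apply: le_trans (normc_ge_Re _).
rewrite lecR; apply: le_trans (ler_norm _).
rewrite raddf_sum/= raddf_sum/=; apply: ler_sum => j _.
rewrite normrEsg -/(th j) linearZ/= raddfB/= /GRing.scale/=.
by case: (f (u j.+1)) (f (u j)) => [a1 b1] [a2 b2] /=; rewrite mul0r subr0.
Qed.

Lemma weak_limit (u : nat -> A) :
  (forall n, nr (u n) <= 1) ->
  (forall f, cvgn (fun n => complex.Re (f (u n)))) ->
  exists q : bidual A, forall f, (f (u n) : R[i]^o) @[n --> \oo] --> (q f : R[i]^o).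
Proof.
move=> u1 uc.
have fu f : exists z : R[i]^o, (f (u n) : R[i]^o) @[n --> \oo] --> z.
  have /cvg_ex[a /cvgrPdist_le fa] := uc f.
  (* The imaginary part of f is the real part of -i f. *)
  have /cvg_ex[b /cvgrPdist_le fb] := uc (- 'i%C *: f).
  exists (a +i* b : R[i]^o); apply/cvg_nrP => e e0.
  have e2 : 0 < e / 2 by rewrite divr_gt0.
  have [N _ aN] := fa _ e2; have [M _ bM] := fb _ e2.
  exists (maxn N M) => n; rewrite geq_max => /andP[Nn Mn].
  have E : complex.Re ((- 'i%C *: f) (u n)) = complex.Im (f (u n)).
    by rewrite dualZE; case: (f (u n)) => z1 z2 /=; rewrite oppr0 mul0r mulN1r opprK add0r.
  have an : `|a - complex.Re (f (u n))| <= e / 2 by exact: aN.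
  have bn : `|b - complex.Im (f (u n))| <= e / 2 by rewrite -E; exact: bM.
  move: an bn; case: (f (u n)) => z1 z2 an bn.
  rewrite (le_trans (nr_complex_le _))//= (_ : e = e / 2 + e / 2) ?lerD//; lra.
have [q qP] := choice fu.
have qlin : linear (q : dual A -> R[i]^o).
  move=> k f g.
  apply: (@norm_cvg_unique _ _ (((k *: f + g) (u n) : R[i]^o) @[n --> \oo])); first exact: qP.
  by apply: cvgD; [apply: cvgZl_tmp; exact: qP|exact: qP].
have qbd f : `|q f| <= 1 * `|f|.
  rewrite nrE nrE -[1]/(1%:C) -rmorphM/= lecR mul1r -(subr0 (q f)).
  apply: (@nr_cvg_le _ _ _ _ _ _ 0%N (qP f)) => n _; rewrite subr0.
  by rewrite (le_trans (nr_dual _ _))// ler_piMr ?nr_ge0.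
by exists (mk_dual qlin qbd).
Qed.

End WeakLimits.

Section RangeProjection.
Variables (R : realType) (A : cstarAlgType R).
Implicit Types (a b c g : A) (f phi : dual A).

Lemma cpositive_ge0 phi a : positive_functional phi -> cpositive a -> 0 <= phi a.
Proof. by move=> phip [b ->]; exact: phip. Qed.

Lemma range_projection g : cstar g = g -> exists q : bidual A,
  [/\ open_projection q, bmul q (embed g) = embed g,
      forall b, cmul b g = 0 -> bmul (embed b) q = 0 &
      forall p : bidual A, bmul (embed g) p = embed g -> proj_le q p].
Proof.
move=> gs; have [r [b [[rs rr rE r1] [gr rpos rvar]]]] := exists_cutoffs g.
pose u n := cmul (r n) (r n).
have rlt m n : (m < n)%N -> cmul (r m) (r n) = r m.
  by move=> /(cutoff_mul rs rr)[].
have rgt m n : (m < n)%N -> cmul (r n) (r m) = r m.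
  by move=> /(cutoff_mul rs rr)[].
have us n : cstar (u n) = u n by rewrite cstarM rs.
have ult m n : (m < n)%N -> cmul (u m) (u n) = u m.
  by move=> mn; rewrite /u cmulA -(cmulA (r m) (r m)) (rlt _ _ mn) -cmulA (rlt _ _ mn).
have ugt m n : (m < n)%N -> cmul (u n) (u m) = u m.
  by move=> /ult mn; rewrite -{1}(us n) -{1}(us m) -cstarM mn us.
have u1 n : nr (u n) <= 1.
  by rewrite (le_trans (nr_cmul _ _))// mulr_ile1 ?nr_ge0.
have [q qP] : exists q : bidual A,
    forall f, (f (u n) : R[i]^o) @[n --> \oo] --> (q f : R[i]^o).
  by apply: weak_limit => // f; exact: dual_bounded_variation_Re rvar.
have lim_eq f (z : R[i]^o) : (f (u n) : R[i]^o) @[n --> \oo] --> z -> q f = z.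
  by move=> fz; exact: (norm_cvg_unique (qP f) fz).
have lim_ev f z N : (forall n, (N <= n)%N -> f (u n) = z) -> q f = z.
  move=> fz; apply: lim_eq; apply/cvg_nrP => e e0; exists N => n /fz ->.
  by rewrite subrr nr0 ltW.
(* A product with q is q evaluated on a translate of f, along which the sequence is eventually
   constant since u_n u_m = u_n for m > n. *)
have uq n : bmul (embed (u n)) q = embed (u n).
  apply: dual_ext => f; apply: (@lim_ev (dualr f (u n)) _ n.+1) => m nm /=.
  by rewrite ult.
have qu n : bmul q (embed (u n)) = embed (u n).
  apply: dual_ext => f; apply: (@lim_ev (bidual_act (embed (u n)) f) _ n.+1) => m nm /=.
  by rewrite ugt.
have qq : bmul q q = q.
  apply: dual_ext => f; apply: lim_eq.
  rewrite (_ : (fun n => _) = fun n => f (u n)); first exact: qP.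
  by apply/funext => n; rewrite -[LHS]/(bmul (embed (u n)) q f) uq.
have qs : bstar q = q.
  apply: dual_ext => f; apply/esym/lim_eq/cvg_nrP => e e0.
  have /cvg_nrP/(_ e e0)[N qN] := qP (dual_star f).
  exists N => n /qN; rewrite /= us; apply: le_trans.
  by rewrite /nr -[X in _ <= complex.Re X]normcJ rmorphB/= conjcK.
have u_pos m n : (m <= n)%N -> cpositive (u n - u m).
  rewrite leq_eqVlt => /predU1P[->|mn].
    by exists 0; rewrite subrr cmul0r.
  have := rpos m (r n); rewrite rs; rewrite (_ : cmul (r n) (cmul (r m) _) = u m)//.
  by rewrite rlt// cmulA rgt.
have u_sq n : cpositive (u n - cmul (u n) (u n)).
  by have := rpos n (r n); rewrite rs /u !cmulA.
have u_sqS n : cpositive (cmul (u n.+1) (u n.+1) - u n).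
  have := rpos n (u n.+1); rewrite us (cmulA (r n) (r n)) -/(u n).
  by rewrite (ult _ _ (ltnSn n)) (ugt _ _ (ltnSn n)).
have gu : (fun n => cmul (u n) g) @ \oo --> g.
  have rg : (fun n => cmul (r n) g) @ \oo --> g.
    rewrite -[X in _ --> X]gs; rewrite (_ : (fun n => _) = fun n => cstar (cmul g (r n))).
      exact: cvg_cstar.
    by apply/funext => n; rewrite cstarM rs gs.
  apply/cvg_nrP => e e0; have e2 : 0 < e / 2 by rewrite divr_gt0.
  have /cvg_nrP/(_ _ e2)[N rN] := rg; exists N => n /rN rn.
  rewrite (le_trans (nr_triangle (cmul (r n) g) _ _))//.
  rewrite -cmulA -cmulBr (_ : e = e / 2 + e / 2); last by lra.
  rewrite lerD// (le_trans (nr_cmul _ _))// (le_trans (ler_piMl _ (r1 n)))//.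
  exact: nr_ge0.
have uE n : u n = cmul (cmul (r n) (cmul (b n) g)) g.
  by rewrite /u {2}rE gs !cmulA.
have uE' n : u n = cmul g (cmul g (cmul (cstar (b n)) (r n))).
  by rewrite -us uE !cstarM gs rs !cmulA.
exists q; split.
- split; first by split.
  exists nat, (fun m n => (m <= n)%N), u; split.
  + split; [exact: (inhabits 0%N)|exact: leqnn| | |exact: u_pos].
      by move=> i j k; exact: leq_trans.
    by move=> i j; exists (maxn i j); rewrite leq_maxl leq_maxr.
  + by move=> n; exists (r n); rewrite rs.
  move=> phi [phip _] e e0.
  have phiB a c : phi (a - c) = phi a - phi c by exact: raddfB.
  have er : (complex.Re e)%:C = e by rewrite RRe_real// gtr0_real.
  have e4 : 0 < complex.Re e / 4 by rewrite divr_gt0// -ltcR er.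
  have /cvg_nrP/(_ _ e4)[N qN] := qP phi.
  exists N.+1 => -[//|n]; rewrite ltnS => Nn; pose v := cmul (u n.+1) (u n.+1).
  rewrite bstarB qs -embed_star us bmulBl !bmulBr qq uq qu -embedM -/v.
  rewrite -[X in `|X|]/((q phi - phi (u n.+1)) - (phi (u n.+1) - phi v) : R[i]^o).
  (* (q - u)^2 = (q - u) - (u - u^2) for u = u_(n+1), and u_n <= u^2 <= u bounds the second term by
     an increment of phi(u_n); hence the successor index. Three errors of e / 4 remain. *)
  have vu : `|phi (u n.+1) - phi v| <= `|phi (u n.+1) - phi (u n)|.
    have v0 : 0 <= phi (u n.+1) - phi v by rewrite -phiB; exact: (cpositive_ge0 phip (u_sq _)).
    have v1 : 0 <= phi v - phi (u n) by rewrite -phiB; exact: (cpositive_ge0 phip (u_sqS _)).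
    have vn : phi (u n.+1) - phi v <= phi (u n.+1) - phi (u n).
      by rewrite lerD2l lerN2 -subr_ge0.
    by rewrite !ger0_norm// (le_trans v0).
  have qn := qN _ Nn; have qSn := qN _ (leqW Nn).
  move: vu; rewrite !nrE lecR -er ltcR => vu.
  have := nrB (q phi - phi (u n.+1) : R[i]^o) (phi (u n.+1) - phi v).
  have := nr_triangle (q phi : R[i]^o) (phi (u n.+1)) (phi (u n)).
  rewrite (nr_distC (phi (u n.+1) : R[i]^o) (q phi)).
  lra.
- apply: dual_ext => f; apply: lim_eq.
  exact: (@cvg_dual _ _ f _ _ gu).
- move=> c cg; apply: dual_ext => f; apply: (@lim_ev (dualr f c) _ 0%N) => n _ /=.
  by rewrite uE' cmulA cg cmul0l raddf0.
- move=> p gp; apply: dual_ext => f; apply: lim_eq.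
  rewrite (_ : (fun n => _) = fun n => f (u n)); first exact: qP.
  apply/funext => n; rewrite -[LHS]/(bmul (embed (u n)) p f).
  by rewrite {1}uE embedM bmulA gp -embedM -uE.
Qed.

End RangeProjection.

(** * Local maps *)

Section LocalMaps.
Variables (R : realType) (A : cstarAlgType R).
Implicit Types (a b g x y : A).

(* [t] represents T on elements of A, and [B] is the left ideal of the a in A
   with a p2 = a. *)
Record local_data (X B : set A) (t : A -> A) : Prop := {
  ld_sub : forall (k : R[i]) x y, X x -> X y -> X (k *: x + y) ;
  ld_lim : forall u x, (forall n : nat, X (u n)) -> u @ \oo --> x -> X x ;
  ld_mul : forall x b, X x -> B b -> X (cmul x b) ;
  ld_XB : X `<=` B ;
  ld_Bsub : forall a b, B a -> B b -> B (a - b) ;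
  ld_Blim : forall u b, (forall n : nat, B (u n)) -> u @ \oo --> b -> B b ;
  ld_Bmul : forall a b, B b -> B (cmul a b) ;
  ld_tB : forall x, X x -> B (t x) ;
  ld_lin : forall (k : R[i]) x y, X x -> X y -> t (k *: x + y) = k *: t x + t y ;
  ld_loc : forall x g, X x -> cstar g = g -> B g -> cmul x g = 0 ->
    cmul (t x) g = 0 }.

Section Cutoff.
Variables (X B : set A) (t : A -> A) (ld : local_data X B t).
Variables (x : A) (Xx : X x) (r b : nat -> A).
Hypotheses (rs : forall j, cstar (r j) = r j)
  (rr : forall j, cmul (r j) (r j.+1) = r j)
  (rE : forall j, r j = cmul (b j) (cmul (cstar x) x))
  (r1 : forall j, nr (r j) <= 1)
  (xr : (fun j => cmul x (r j)) @ \oo --> x).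

Let w := t x.

Lemma cutoff_B j : B (r j).
Proof. by rewrite rE cmulA; apply: (ld_Bmul ld); exact: (ld_XB ld). Qed.

Lemma cutoff_lt m n : (m < n)%N -> cmul (r m) (r n) = r m.
Proof. by move=> /(cutoff_mul rs rr)[]. Qed.

Lemma cutoff_gt m n : (m < n)%N -> cmul (r n) (r m) = r m.
Proof. by move=> /(cutoff_mul rs rr)[]. Qed.

(* Gliding hump: were (w r_j) not Cauchy, there would be disjoint shells
   g_n = r_(c_n) - r_(a_n + 1) with |w g_n| > e, and an element y of X equal to
   2^n x on the n-th shell; by locality t y = 2^n w there, which is absurd. *)
Lemma local_cutoff_cvg : cvgn (fun j => cmul w (r j)).
Proof.
apply: nr_cauchy_cvg => e e0; apply: contrapT => /forallNP not_cauchy.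
(* The shell starts at the successor of [s.1], which leaves one cutoff below it for the wider shell
   h_n. *)
have gap N : exists s : nat * nat, [/\ (N <= s.1)%N, (s.1 < s.2)%N &
    e < nr (cmul w (r s.2 - r s.1.+1))].
  have /existsNP[m /existsNP[n /not_implyP[/andP[Nm mn] /negP]]] := not_cauchy N.+1.
  rewrite -ltNge -cmulBr => en.
  case: m Nm mn en => // m; rewrite ltnS => Nm mn en.
  by exists (m, n).
(* The rate beats the weights 2^n: the n-th term of y will have norm at most 2 / 2^n. *)
have small n : exists M, forall j, (M <= j)%N -> nr (x - cmul x (r j)) <= 4^-1 ^+ n.
  by have /cvg_nrP := xr; apply; rewrite exprn_gt0// invr_gt0.
have [F FP] := choice gap; have [M MP] := choice small.
pose s := fix s n := if n is m.+1 then F (maxn (M m.+1) (s m).2.+1) else F (M 0%N).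
pose a n := (s n).1; pose c n := (s n).2.
have aM n : (M n <= a n)%N.
  case: n => [|n]; first by have [] := FP (M 0%N).
  by have [+ _ _] := FP (maxn (M n.+1) (s n).2.+1); apply: leq_trans; exact: leq_maxl.
have ac n : (a n < c n)%N.
  case: n => [|n]; first by have [] := FP (M 0%N).
  by have [] := FP (maxn (M n.+1) (s n).2.+1).
have ca n : (c n < a n.+1)%N.
  by have [+ _ _] := FP (maxn (M n.+1) (s n).2.+1); apply: leq_trans; exact: leq_maxr.
have ew n : e < nr (cmul w (r (c n) - r (a n).+1)).
  case: n => [|n]; first by have [] := FP (M 0%N).
  by have [] := FP (maxn (M n.+1) (s n).2.+1).
have ca_lt m n : (m < n)%N -> (c m < a n)%N.
  elim: n => // n IH; rewrite ltnS leq_eqVlt => /predU1P[->//|/IH mn].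
  by rewrite (ltn_trans mn)// (ltn_trans (ac n)).
(* One step wider than g_n on both sides, h_n acts on g_n as a unit and still kills the other
   shells. *)
pose h n := r (c n).+1 - r (a n); pose g n := r (c n) - r (a n).+1.
have hg n : cmul (h n) (g n) = g n.
  rewrite /h /g cmulBl !cmulBr cutoff_gt// cutoff_gt ?ltnS//.
  rewrite (@cutoff_lt (a n) (c n))// (@cutoff_lt (a n) (a n).+1)//.
  by rewrite subrr subr0.
have hg0 m n : m != n -> cmul (h m) (g n) = 0.
  rewrite neq_ltn => /orP[mn|nm]; rewrite /h /g cmulBl !cmulBr.
    have cman := ca_lt _ _ mn.
    have amn := ltn_trans (ac m) cman.
    rewrite (@cutoff_lt (c m).+1 (c n)) ?(leq_ltn_trans cman)//.
    rewrite (@cutoff_lt (c m).+1 (a n).+1)//.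
    rewrite (@cutoff_lt (a m) (c n)) ?(ltn_trans amn)//.
    by rewrite (@cutoff_lt (a m) (a n).+1) ?subrr// ltnW.
  have cnam := ca_lt _ _ nm.
  have ancm := leq_ltn_trans (ac n) (ltn_trans cnam (ac m)).
  rewrite (@cutoff_gt (c n) (c m).+1) ?(ltn_trans (ltn_trans cnam (ac m)))//.
  rewrite (@cutoff_gt (a n).+1 (c m).+1) ?(ltn_trans ancm)//.
  rewrite (@cutoff_gt (c n) (a m))// (@cutoff_gt (a n).+1 (a m)) ?subrr//.
  exact: leq_ltn_trans (ac n) cnam.
have gB n : B (g n) by apply: (ld_Bsub ld); exact: cutoff_B.
have hB n : B (h n) by apply: (ld_Bsub ld); exact: cutoff_B.
have gs n : cstar (g n) = g n by rewrite cstarB !rs.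
have g2 n : nr (g n) <= 2.
  by apply: le_trans (nrB _ _) _; have := r1 (c n); have := r1 (a n).+1; lra.
pose y n := \sum_(m < n) (2 ^+ m)%:C *: cmul x (h m).
have yS n : y n.+1 = (2 ^+ n)%:C *: cmul x (h n) + y n.
  by rewrite /y big_ord_recr/= addrC.
have X0 : X 0 by have := ld_sub ld (-1) Xx Xx; rewrite scaleN1r addNr.
have yX n : X (y n).
  elim: n => [|n IH]; first by rewrite /y big_ord0.
  by rewrite yS; apply: (ld_sub ld) => //; exact: (ld_mul ld).
have yg n m : (n < m)%N -> cmul (y m) (g n) = (2 ^+ n)%:C *: cmul x (g n).
  have y0 i : (i <= n)%N -> cmul (y i) (g n) = 0.
    elim: i => [|i IH] ni; first by rewrite /y big_ord0 cmul0l.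
    rewrite yS cmulDl cmulZl -cmulA hg0 ?cmul0r ?scaler0 ?add0r ?IH// 1?ltnW//.
    by rewrite neq_ltn ni.
  elim: m => // m IH; rewrite ltnS leq_eqVlt => /predU1P[<-|nm].
    by rewrite yS cmulDl cmulZl -cmulA hg y0// addr0.
  rewrite yS cmulDl cmulZl -cmulA hg0 ?IH// ?cmul0r ?scaler0 ?add0r//.
  by rewrite neq_ltn nm orbT.
have /cvg_ex[/= z yz] : cvgn y.
  apply: (@dominated_cvg _ _ _ (fun n => - (4 * 2^-1 ^+ n)) 0).
  - move=> n; rewrite yS addrK nrZ ger0_norm ?exprn_ge0//.
    have xh : nr (cmul x (h n)) <= 2 * 4^-1 ^+ n.
      rewrite /h cmulBr; apply: le_trans (nr_triangle x _ _) _.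
      rewrite nr_distC (_ : 2 * _ = 4^-1 ^+ n + 4^-1 ^+ n); last by ring.
      by rewrite lerD// MP// ltnW// (leq_ltn_trans (aM n))// ltnS ltnW.
    apply: le_trans (ler_wpM2l (exprn_ge0 n (ler0n R 2)) xh) _.
    rewrite (_ : 4^-1 = 2^-1 * 2^-1 :> R); last by field.
    rewrite exprMn exprS !mulrA [2 ^+ n * 2]mulrC -(mulrA 2) -exprMn.
    rewrite mulfV ?pnatr_eq0// expr1n; lra.
  - move=> n; rewrite lerN2 exprS.
    have : 0 <= 2^-1 ^+ n :> R by rewrite exprn_ge0// invr_ge0.
    lra.
  - by move=> n; rewrite oppr_le0 mulr_ge0// exprn_ge0// invr_ge0.
have zX : X z by exact: (ld_lim ld) yX yz.
have zg n : cmul z (g n) = (2 ^+ n)%:C *: cmul x (g n).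
  apply: (@norm_cvg_unique _ _ (cmul (y m) (g n) @[m --> \oo])); first exact: cvg_cmulr.
  apply/cvg_nrP => d d0; exists n.+1 => m nm.
  by rewrite yg// subrr nr0 ltW.
have tz n : cmul (t z) (g n) = (2 ^+ n)%:C *: cmul w (g n).
  (* Locality is applied to z - 2^n x, which annihilates g_n. *)
  have := ld_loc ld (ld_sub ld (- (2 ^+ n)%:C) Xx zX) (gs n) (gB n).
  rewrite cmulDl cmulZl zg scaleNr addNr => /(_ erefl).
  by rewrite (ld_lin ld)// cmulDl cmulZl scaleNr addrC => /subr0_eq.
have bound n : 2 ^+ n * e <= nr (t z) * 2.
  have := nr_cmul (t z) (g n); rewrite tz nrZ ger0_norm ?exprn_ge0// => tzn.
  apply: le_trans (ler_wpM2l (exprn_ge0 n (ler0n R 2)) (ltW (ew n))) _.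
  by apply: le_trans tzn _; rewrite ler_wpM2l ?nr_ge0.
have [n nP] : exists n : nat, nr (t z) * 2 / e < n%:R.
  by exists (Num.truncn (nr (t z) * 2 / e)).+1; exact: truncnS_gt.
have : n%:R <= 2 ^+ n :> R by rewrite -natrX ler_nat ltnW// ltn_expl.
move: nP; rewrite ltr_pdivrMr// => nP n2.
by have := bound n; have := ler_wpM2r (ltW e0) n2; lra.
Qed.

Lemma local_cutoff_cvg_to : (fun j => cmul w (r j)) @ \oo --> w.
Proof.
have /cvg_ex[/= l wl] := local_cutoff_cvg.
pose v := w - l.
(* w r_j r_i = w r_i as soon as j > i, so w and its candidate limit agree against each cutoff. *)
have vr i : cmul v (r i) = 0.
  rewrite cmulBl; apply/eqP; rewrite subr_eq0; apply/eqP.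
  apply: (@norm_cvg_unique _ _ (cmul (cmul w (r j)) (r i) @[j --> \oo])); last exact: cvg_cmulr.
  apply/cvg_nrP => d d0; exists i.+1 => j ij.
  by rewrite -cmulA cutoff_gt// subrr nr0 ltW.
have rv i : cmul (r i) (cstar v) = 0 by rewrite -(rs i) -cstarM vr cstar0.
have xv : cmul x (cstar v) = 0.
  apply: (@norm_cvg_unique _ _ (cmul (cmul x (r j)) (cstar v) @[j --> \oo])); first exact: cvg_cmulr.
  by apply/cvg_nrP => d d0; exists 0%N => j _; rewrite -cmulA rv cmul0r subrr nr0 ltW.
have lv : cmul l (cstar v) = 0.
  apply: (@norm_cvg_unique _ _ (cmul (cmul w (r j)) (cstar v) @[j --> \oo])); first exact: cvg_cmulr.
  by apply/cvg_nrP => d d0; exists 0%N => j _; rewrite -cmulA rv cmul0r subrr nr0 ltW.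
have vB : B v.
  apply: (ld_Bsub ld); first exact: (ld_tB ld).
  by apply: (ld_Blim ld) wl => n; apply: (ld_Bmul ld); exact: cutoff_B.
pose g := cmul (cstar v) v.
have gs : cstar g = g by rewrite cstarM cstarK.
have wg : cmul w g = 0.
  apply: (ld_loc ld) => //; first exact: (ld_Bmul ld).
  by rewrite cmulA xv cmul0l.
(* The limit l kills [cstar v], so v g = w g; then g^2 = 0. *)
have vg : cmul v g = 0.
  by rewrite -wg /g !cmulA; congr (cmul _ v); rewrite cmulBl lv subr0.
have g0 : g = 0 by apply: cstar_cmul_eq0; rewrite gs {1}/g -cmulA vg cmul0r.
have v0 : v = 0 by exact: cstar_cmul_eq0.
have E : l = w by exact/esym/subr0_eq.
by move: wl; rewrite E.
Qed.

End Cutoff.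
End LocalMaps.

(** * Embedding into the bidual; null vectors of positive functionals *)

Section Bidual.
Variables (R : realType) (A : cstarAlgType R).
Implicit Types (a b : A) (f phi : dual A) (F G H : bidual A).

Lemma bmulDZl (k : R[i]) F G H : bmul (k *: F + G) H = k *: bmul F H + bmul G H.
Proof. exact: dual_ext. Qed.

Lemma bmulDZr (k : R[i]) F G H : bmul F (k *: G + H) = k *: bmul F G + bmul F H.
Proof.
apply: dual_ext => f; rewrite dualDE dualZE /= -[k * _]/(k *: (_ : R[i]^o)) -linearP.
by congr (F _); exact: dual_ext.
Qed.

Lemma embedDZ (k : R[i]) a b : embed (k *: a + b) = k *: embed a + embed b.
Proof. by apply: dual_ext => f; rewrite dualDE dualZE /= linearP. Qed.

(** The place where Hahn-Banach enters: identities proved in the bidual return to A. *)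
Lemma embed_inj : injective (@embed R A).
Proof.
move=> a b ab; apply/subr0_eq/dual_separates => f.
by rewrite raddfB; have /= -> := congr1 (fun F : bidual A => F f) ab; rewrite subrr.
Qed.

Lemma nr_embed a : nr (embed a) <= nr a.
Proof.
rewrite -lecR -nrE; apply: dual_norm_le; first exact: nr_ge0.
by move=> f; rewrite -nrE; exact: embed_subproof2.
Qed.

Lemma nr_bmul F G f : nr (bmul F G f : R[i]^o) <= nr F * nr G * nr f.
Proof. by rewrite -lecR !rmorphM/= -!nrE; exact: bmul_subproof2. Qed.

Lemma cvg_bmull F f (u : nat -> A) a : u @ \oo --> a ->
  (bmul F (embed (u n)) f : R[i]^o) @[n --> \oo] --> (bmul F (embed a) f : R[i]^o).
Proof.
apply: (@cvg_bounded_additive _ _ R[i]^o (fun a => bmul F (embed a) f) (nr F * nr f)).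
  by move=> x y; rewrite embedB bmulBr.
move=> v; apply: le_trans (nr_bmul _ _ _) _.
by rewrite mulrAC ler_wpM2l ?mulr_ge0 ?nr_ge0 ?nr_embed.
Qed.

Lemma cvg_bmulr F f (u : nat -> A) a : u @ \oo --> a ->
  (bmul (embed (u n)) F f : R[i]^o) @[n --> \oo] --> (bmul (embed a) F f : R[i]^o).
Proof. by move=> ua; exact: (@cvg_dual _ _ (bidual_act F f) _ _ ua). Qed.

Lemma affine_ge0_eq0 (c d : R) : (forall t, 0 <= c + t * d) -> d = 0.
Proof.
move=> cd; apply/eqP; apply: contraT => d0.
have := cd (- (c + 1) / d); rewrite divfK//; lra.
Qed.

(** The null case of Cauchy-Schwarz: the value of phi at the square of b + s a has no quadratic term
    in s, so for s real or imaginary it is affine and nonnegative, and its slope vanishes. *)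
Lemma positive_functional_null phi a b : positive_functional phi ->
  phi (cmul (cstar a) a) = 0 -> phi (cmul b a) = 0.
Proof.
move=> phip a0; rewrite -(cstarK b); move: (cstar b) => {}b.
set u := phi (cmul (cstar b) a); pose v := phi (cmul (cstar a) b).
set d := phi (cmul (cstar b) b).
have key (s : R[i]) : 0 <= d + (s * u + s^*%C * v).
  have := phip (b + s *: a).
  rewrite cstarD cstarZ !cmulDl !cmulDr !cmulZl !cmulZr !raddfD/= !linearZ/= a0.
  by rewrite /GRing.scale/= !mulr0 addr0 -/u -/v -/d addrA.
have d_real : 0 <= d by exact: phip.
case: u v d d_real key => [u1 u2] [v1 v2] [d1 d2].
rewrite lecE/= => /andP[/eqP -> d10] key.
(* In [R[i]], being nonnegative includes being real, whence one equation besides the inequality. *)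
have re (t : R) : t * (u2 + v2) = 0 /\ 0 <= d1 + t * (u1 + v1).
  have := key t%:C; rewrite lecE/= => /andP[/eqP E H].
  by split; [move: E|move: H]; lra.
have im (t : R) : t * (u1 - v1) = 0 /\ 0 <= d1 + t * (v2 - u2).
  have := key (0 +i* t); rewrite lecE/= => /andP[/eqP E H].
  by split; [move: E|move: H]; lra.
have uv1 := affine_ge0_eq0 (fun t => (re t).2).
have uv2 := affine_ge0_eq0 (fun t => (im t).2).
have [re1 _] := re 1; have [im1 _] := im 1.
apply/eqP; rewrite eq_complex/=; apply/andP; split; apply/eqP; lra.
Qed.

End Bidual.

(** * Transfer of the hypotheses to the algebra *)

Section Final.
Variables (R : realType) (A : cstarAlgType R) (p1 p2 : bidual A).
Variable T : bidual A -> bidual A.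

(** Idempotency turns membership in the corner into two equations, which survive sums and norm
    limits. *)
Lemma XspaceP x : projection p1 -> projection p2 ->
  Xspace p1 p2 (embed x) <->
  bmul p1 (embed x) = embed x /\ bmul (embed x) p2 = embed x.
Proof.
move=> [p11 _] [p22 _]; split=> [[_ [F _ FE]]|[p1x xp2]].
  by rewrite -FE; split; [rewrite -!bmulA p11|rewrite bmulA p22].
by split; [exists x|exists (embed x) => //; rewrite p1x].
Qed.

Lemma local_map_data : open_projection p1 -> open_projection p2 ->
  linear_map (Xspace p1 p2) (Xspace1 p2) T -> local_map (Xspace p1 p2) p2 T ->
  exists2 t : A -> A, forall x, Xspace p1 p2 (embed x) -> T (embed x) = embed (t x) &
    local_data [set x | Xspace p1 p2 (embed x)]
      [set b | bmul (embed b) p2 = embed b] t.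
Proof.
move=> [p1p _] [p2p _] [TX Tlin] Tloc.
have XP x := XspaceP x p1p p2p; have p22 : bmul p2 p2 = p2 by have [] := p2p.
have /choice[t tE] : forall x, exists w, Xspace p1 p2 (embed x) -> T (embed x) = embed w.
  move=> x; have [/TX[[w _ wE] _]|nX] := pselect (Xspace p1 p2 (embed x)).
    by exists w.
  (* A default value off the domain of T, where the condition on t is vacuous. *)
  by exists 0.
exists t => //; split => /=.
- move=> k x y /XP[x1 x2] /XP[y1 y2]; apply/XP.
  by rewrite embedDZ bmulDZl bmulDZr x1 x2 y1 y2.
- move=> u x uX ux; apply/XP; split; apply: dual_ext => f.
    apply: (@norm_cvg_unique _ _ ((bmul p1 (embed (u n)) f : R[i]^o) @[n --> \oo])).
      exact: cvg_bmull.
    rewrite (_ : (fun n => _) = fun n => embed (u n) f); first exact: (@cvg_dual _ _ f _ _ ux).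
    by apply/funext => n; have /XP[-> _] := uX n.
  apply: (@norm_cvg_unique _ _ ((bmul (embed (u n)) p2 f : R[i]^o) @[n --> \oo])).
    exact: cvg_bmulr.
  rewrite (_ : (fun n => _) = fun n => embed (u n) f); first exact: (@cvg_dual _ _ f _ _ ux).
  by apply/funext => n; have /XP[_ ->] := uX n.
- move=> x b /XP[x1 x2] bB; apply/XP; rewrite embedM.
  by split; [rewrite -bmulA x1|rewrite bmulA bB].
- by move=> x /XP[].
- by move=> a b aB bB; rewrite embedB bmulBl aB bB.
- move=> u b uB ub; apply: dual_ext => f.
  apply: (@norm_cvg_unique _ _ ((bmul (embed (u n)) p2 f : R[i]^o) @[n --> \oo])).
    exact: cvg_bmulr.
  rewrite (_ : (fun n => _) = fun n => embed (u n) f); first exact: (@cvg_dual _ _ f _ _ ub).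
  by apply/funext => n; rewrite uB.
- by move=> a b bB; rewrite embedM bmulA bB.
- by move=> x xX; rewrite -tE//; have [_ [F _ <-]] := TX _ xX; rewrite bmulA p22.
- move=> k x y xX yX; apply: embed_inj.
  have kX : Xspace p1 p2 (embed (k *: x + y)).
    apply/XP; move/XP: xX => [x1 x2]; move/XP: yX => [y1 y2].
    by rewrite embedDZ bmulDZl bmulDZr x1 x2 y1 y2.
  by rewrite -tE// !embedDZ Tlin// -!tE.
- move=> x g xX gs gB xg; apply: embed_inj.
  have [q [qo qg q0 qp]] := range_projection gs.
  (* q lies below p2 because g p2 = g, and x q = 0 because x g = 0; the conclusion (T x) q = 0 is
     multiplied by g = q g. *)
  have Tq := Tloc _ qo (qp _ gB) _ xX (q0 _ xg).
  rewrite embedM -tE// -qg -bmulA Tq.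
  by apply: dual_ext => f; rewrite /= raddf0.
Qed.

End Final.

Theorem theorem5p2 (R : realType) (A : cstarAlgType R) (p1 p2 : bidual A)
    (T : bidual A -> bidual A) :
  open_projection p1 -> open_projection p2 ->
  linear_map (Xspace p1 p2) (Xspace1 p2) T ->
  local_map (Xspace p1 p2) p2 T ->
  purely_decomposable (Xspace p1 p2) T.
Proof.
move=> p1o p2o Tlin Tloc phi [[phip _] _] F FX.
have [[x _ xF] _] := FX; rewrite -{F}xF in FX *.
have [t tE ld] := local_map_data p1o p2o Tlin Tloc.
rewrite tE// -!embed_star -!embedM => phix.
have [r [b [[rs rr rE r1] [xr _ _]]]] := exists_cutoffs x.
have wr := local_cutoff_cvg_to ld FX rs rr rE r1 xr.
rewrite -[LHS]/(phi (cmul (cstar (t x)) (t x)) : R[i]^o).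
apply: (@norm_cvg_unique _ _
  ((phi (cmul (cstar (t x)) (cmul (t x) (r n))) : R[i]^o) @[n --> \oo])).
  apply: (@cvg_dual _ _ phi); exact: cvg_cmull wr.
(* By [rE] every term has x as its right factor, so phi vanishes along the whole sequence. *)
apply/cvg_nrP => e e0; exists 0%N => n _.
by rewrite rE !cmulA positive_functional_null// subrr nr0 ltW.
Qed.
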